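(* Let $2\le r\le k$ be integers with $k\ge 4$ or $r\ge 3$. Then there is a constant $c=c(k)>0$ such that every $k$-uniform linear hypergraph with $m$ edges has an $r$-cut of surplus at least $c\,m^{3/4}$.
   Context: A hypergraph is linear if any two distinct edges share at most one vertex. An $r$-cut of a $k$-uniform hypergraph is a partition of its vertex set into $r$ parts; its size is the number of edges with at least one vertex in each part. The surplus of an $r$-cut in a $k$-uniform hypergraph with $m$ edges is its size minus $\frac{S(k,r)\,r!}{r^k}m$, where $S(k,r)$ is the Stirling number of the second kind (the expected size of a uniformly random $r$-cut). *)

(* Defs.v *)
From mathcomp Require Import all_boot all_order all_algebra.
From mathcomp Require Import all_classical all_reals all_analysis.
Set Implicit Arguments.
Unset Strict Implicit.
Unset Printing Implicit Defensive.
Import Order.TTheory GRing.Theory Num.Theory.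
Local Open Scope ring_scope.

(* A finite hypergraph on a vertex set V : finType is given by its edge set
   E : {set {set V}}. *)

Definition uniform_hypergraph (V : finType) (k : nat) (E : {set {set V}}) : Prop :=
  forall e : {set V}, e \in E -> #|e| = k.

Definition linear_hypergraph (V : finType) (E : {set {set V}}) : Prop :=
  forall e1 e2 : {set V},
    e1 \in E -> e2 \in E -> e1 <> e2 -> (#|e1 :&: e2| <= 1)%N.

(* An r-cut is encoded by the map sending each vertex to the index of its part,
   so parts may be empty; the uniformly random r-cut, which has expected size
   S(k,r) r! / r^k * m, is the uniform such map. If an edge meets every part,
   all parts are nonempty. *)
Definition r_cut (V : finType) (r : nat) : Type := {ffun V -> 'I_r}.

Definition cut_part (V : finType) (r : nat) (f : r_cut V r) (i : 'I_r) : {set V} :=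
  [set x | f x == i].

Definition cut_size (V : finType) (r : nat) (E : {set {set V}}) (f : r_cut V r)
    : nat :=
  #|[set e in E | [forall i : 'I_r, e :&: cut_part f i != finset.set0]]|.

(* Stirling number of the second kind: the number of partitions of a k-element
   set into r blocks; finset's [partition] requires the blocks to be nonempty. *)
Definition stirling2 (k r : nat) : nat :=
  #|[set P : {set {set 'I_k}} | finset.partition P [set: 'I_k] & #|P| == r]|.

Definition surplus (R : realType) (V : finType) (k r : nat) (E : {set {set V}})
    (f : r_cut V r) : R :=
  (cut_size E f)%:R - (stirling2 k r * r`!)%:R / r%:R ^+ k * #|E|%:R.

(* Main.v *)
Require Import Defs.
From mathcomp Require Import all_boot all_order all_algebra all_fingroup.
From mathcomp Require Import ring lra reals topology normedtype sequences derive exp trigo.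
Set Implicit Arguments.
Unset Strict Implicit.
Unset Printing Implicit Defensive.
Import Order.TTheory GRing.Theory Num.Theory.
Import numFieldNormedType.Exports.
Local Open Scope ring_scope.

(* Vertices of degree at most D, with D of order sqrt m, meet at least half of the
   edges. Give the vertices random types 0, ..., k-1; an edge is good if its types
   are distinct and its vertex of type 0 has degree at most D, so for some choice
   of types a positive proportion of the edges is good. Colour all vertices
   uniformly at random, and then bias the colour of each low-degree vertex v of
   type 0 towards colour 0 or 1 according to sin (signal v), where the signal is
   D^(-1/2) times the sum, over the good edges e containing v, of theta of the
   colour of the type 1 vertex of e times a sign coef e. This sign has mean zero
   and depends only on the vertices of e of type at least 2; it is correlated with
   the effect of the pair (type 0 vertex, type 1 vertex) on e being cut, and such a
   sign exists exactly because k >= 4 or r >= 3. For a bias of strength p, each good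
   edge gains order p D^(-1/2) in expectation. The price is paid by edges with at
   least two biased vertices, and it is only O(p^2 D^(-1/2)) per edge: the mean of
   a product of sines is a signed sum of means of cosines of combinations of
   signals, which factor over the type 1 vertices, and the signals of different
   vertices are nearly orthogonal because the coefficients have mean zero. A small
   constant p therefore gives surplus of order m D^(-1/2), that is, m^(3/4). *)

(** * Real inequalities *)

Section RealBounds.
Context {R : realType}.
Implicit Types x y z u : R.

Lemma sin_mvt x : 0 <= x -> exists2 y, 0 <= y <= x & sin x = cos y * x.
Proof.
move=> x0.
have [|y] := @MVT_segment R (@sin R) (@cos R) 0 x x0.
  exact/continuous_subspaceT/continuous_sin.
by rewrite in_itv sin0 !subr0; exists y.
Qed.

Lemma cos_half x : cos x = 1 - 2 * sin (x / 2) ^+ 2.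
Proof.
have {1}-> : x = (x / 2) *+ 2 by rewrite -mulr_natr divfK ?pnatr_eq0.
by rewrite cos_mulr2n cos2sin2; ring.
Qed.

Lemma sin_sqr_le x : sin x ^+ 2 <= x ^+ 2.
Proof.
wlog x0 : x / 0 <= x => [H|].
  have [/H//|/ltW x0] := leP 0 x.
  by have := H (- x); rewrite oppr_ge0 sinN !sqrrN; apply.
rewrite -[sin x ^+ 2]real_normK ?num_real// ler_sqr ?nnegrE//.
by have [y _ ->] := sin_mvt x0; rewrite normrM (ger0_norm x0) ler_piMl// cos_max.
Qed.

Lemma cos_ge x : 1 - x ^+ 2 / 2 <= cos x.
Proof.
rewrite cos_half; have := sin_sqr_le (x / 2).
have -> : (x / 2) ^+ 2 = x ^+ 2 / 4 by field.
lra.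
Qed.

Lemma sin_ge x : 0 <= x -> x - x ^+ 3 / 2 <= sin x.
Proof.
move=> x0; have [y /andP[y0 yx] ->] := sin_mvt x0.
have h : 1 - x ^+ 2 / 2 <= cos y.
  apply: le_trans (cos_ge y); have : y ^+ 2 <= x ^+ 2 by rewrite ler_sqr ?nnegrE.
  lra.
have := ler_wpM2r x0 h; rewrite !exprS expr0; lra.
Qed.

Lemma sin_ge_half x : 0 <= x <= 1 -> x / 2 <= sin x.
Proof.
move=> /andP[x0 x1]; apply: le_trans (sin_ge x0).
have : x * x ^+ 2 <= x by rewrite ler_piMr// expr_le1.
by rewrite -exprS; lra.
Qed.

Lemma sin_sqr_ge x : x ^+ 2 - x ^+ 4 <= sin x ^+ 2.
Proof.
wlog x0 : x / 0 <= x => [H|].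
  have [/H//|/ltW x0] := leP 0 x.
  have x4 : (- x) ^+ 4 = x ^+ 4 by rewrite -[4%N]/(2 * 2)%N !exprM sqrrN.
  by have := H (- x); rewrite oppr_ge0 sinN x4 !sqrrN; apply.
have [h|/ltW h] := leP (x ^+ 2) 1.
  have s := sin_ge x0.
  have h0 : 0 <= x - x ^+ 3 / 2 by have := ler_wpM2r x0 h; rewrite !exprS expr0; lra.
  have : (x - x ^+ 3 / 2) ^+ 2 <= sin x ^+ 2.
    by rewrite ler_sqr ?nnegrE// (le_trans h0).
  apply: le_trans.
  have -> : (x - x ^+ 3 / 2) ^+ 2 = x ^+ 2 - x ^+ 4 + (x ^+ 3 / 2) ^+ 2 by field.
  by rewrite lerDl sqr_ge0.
apply: le_trans (sqr_ge0 _); rewrite subr_le0.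
by rewrite -[4%N]/(2 + 2)%N exprD ler_peMl ?sqr_ge0.
Qed.

(** The half-angle formula reduces this to the two bounds on [sin (x / 2) ^+ 2]; it holds for every
    real [x], without smallness. *)
Lemma cos_taylor2 x : `|1 - cos x - x ^+ 2 / 2| <= x ^+ 4 / 8.
Proof.
have a := sin_sqr_le (x / 2); have b := sin_sqr_ge (x / 2).
have c : 0 <= x ^+ 4 by rewrite -[4%N]/(2 * 2)%N exprM sqr_ge0.
have d : (x / 2) ^+ 4 = x ^+ 4 / 16 by field.
have d2 : (x / 2) ^+ 2 = x ^+ 2 / 4 by field.
move: a b; rewrite cos_half d d2 ler_norml => a b.
by apply/andP; split; lra.
Qed.

Lemma expRN_taylor1 u : 0 <= u -> `|expR (- u) - (1 - u)| <= u ^+ 2.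
Proof.
move=> u0; have a := expR_ge1Dx (- u).
rewrite ger0_norm ?subr_ge0//.
have b := expR_ge1Dx u.
have up : 0 < 1 + u by lra.
have : expR (- u) <= (1 + u)^-1 by rewrite expRN lef_pV2// posrE expR_gt0.
have : (1 + u)^-1 <= 1 - u + u ^+ 2.
  rewrite -[leLHS]mul1r ler_pdivrMr//.
  have -> : (1 - u + u ^+ 2) * (1 + u) = 1 + u ^+ 3 by ring.
  by rewrite lerDl exprn_ge0.
lra.
Qed.

Lemma expRN_lipschitz x y : 0 <= x -> 0 <= y ->
  `|expR (- x) - expR (- y)| <= `|x - y|.
Proof.
wlog xy : x y / x <= y => [H|x0 _].
  by have [/H|/ltW/H h ? ?] := leP x y; [apply|rewrite distrC [leRHS]distrC h].
have -> : expR (- y) = expR (- x) * expR (- (y - x)) by rewrite -expRD; congr expR; ring.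
rewrite -{1}[expR (- x)]mulr1 -mulrBr normrM.
have e1 : `|expR (- x)| <= 1.
  by rewrite ger0_norm ?expR_ge0// -expR0 ler_expR oppr_le0.
apply: le_trans (ler_wpM2r _ e1) _ => //; rewrite mul1r [leRHS]distrC.
have d0 : 0 <= y - x by rewrite subr_ge0.
have e2 : expR (- (y - x)) <= 1 by rewrite -expR0 ler_expR oppr_le0.
rewrite !ger0_norm ?subr_ge0//.
by have := expR_ge1Dx (- (y - x)); lra.
Qed.

(** Telescoping: the factors are exchanged one at a time, and all the others have absolute value at
    most 1. *)
Lemma ler_norm_prodB (I : Type) (s : seq I) (P : pred I) (F G : I -> R) :
  (forall i, P i -> `|F i| <= 1) -> (forall i, P i -> `|G i| <= 1) ->
  `|\prod_(i <- s | P i) F i - \prod_(i <- s | P i) G i| <=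
  \sum_(i <- s | P i) `|F i - G i|.
Proof.
move=> F1 G1.
have : `|\prod_(i <- s | P i) F i| <= 1 /\
  `|\prod_(i <- s | P i) F i - \prod_(i <- s | P i) G i| <=
  \sum_(i <- s | P i) `|F i - G i|; last by case.
elim/big_rec3 : _ => [|i z y x Pi [x1 h]]; first by rewrite subrr normr0 normr1.
split; first by rewrite normrM mulr_ile1// F1.
have -> : F i * x - G i * y = (F i - G i) * x + G i * (x - y) by ring.
apply: le_trans (ler_normD _ _) _; rewrite !normrM lerD//.
  by rewrite ler_piMr.
by apply: le_trans h; rewrite ler_piMl ?G1.
Qed.

End RealBounds.

(** * Uniform random colourings *)

Section Expectation.
Context {R : realFieldType} {V C : finType}.
Implicit Types (S T : {set V}) (s t : {ffun V -> C}) (F G : {ffun V -> C} -> R).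

Definition expect F : R := #|{ffun V -> C}|%:R^-1 * \sum_s F s.

(** Finite form of measurability with respect to the coordinates in [S]; independence comes from
    disjoint supports. *)
Definition depends_on (A : Type) S (F : {ffun V -> C} -> A) :=
  forall s t, {in S, s =1 t} -> F s = F t.

Lemma eq_expect F G : F =1 G -> expect F = expect G.
Proof. by move=> FG; congr (_ * _); apply: eq_bigr. Qed.

Lemma expectD F G : expect (fun s => F s + G s) = expect F + expect G.
Proof. by rewrite /expect big_split mulrDr. Qed.

Lemma expectZ a F : expect (fun s => a * F s) = a * expect F.
Proof. by rewrite /expect -mulr_sumr mulrCA. Qed.

Lemma expectN F : expect (fun s => - F s) = - expect F.
Proof. by rewrite -mulN1r -expectZ; apply: eq_expect => s; rewrite mulN1r. Qed.

Lemma expectB F G : expect (fun s => F s - G s) = expect F - expect G.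
Proof. by rewrite expectD expectN. Qed.

Lemma expect_sum (I : Type) (r : seq I) (P : pred I) (F : I -> {ffun V -> C} -> R) :
  expect (fun s => \sum_(i <- r | P i) F i s) = \sum_(i <- r | P i) expect (F i).
Proof. by rewrite /expect exchange_big mulr_sumr. Qed.

Lemma ler_expect F G : (forall s, F s <= G s) -> expect F <= expect G.
Proof. by move=> FG; rewrite ler_wpM2l ?invr_ge0// ler_sum. Qed.

Lemma expect_ge0 F : (forall s, 0 <= F s) -> 0 <= expect F.
Proof. by move=> F0; rewrite mulr_ge0 ?invr_ge0// sumr_ge0. Qed.

Lemma ler_norm_expect F : `|expect F| <= expect (fun s => `|F s|).
Proof. by rewrite normrM ger0_norm ?invr_ge0// ler_wpM2l ?invr_ge0// ler_norm_sum. Qed.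

Lemma depends_onS (A : Type) S T (F : {ffun V -> C} -> A) :
  S \subset T -> depends_on S F -> depends_on T F.
Proof. by move=> /subsetP ST dF s t st; apply: dF => x /ST; apply: st. Qed.

Lemma depends_on_comp (A B : Type) S (h : A -> B) (F : {ffun V -> C} -> A) :
  depends_on S F -> depends_on S (fun s => h (F s)).
Proof. by move=> dF s t /dF ->. Qed.

Lemma depends_on_comp2 (A B D : Type) S (h : A -> B -> D)
    (F : {ffun V -> C} -> A) (G : {ffun V -> C} -> B) :
  depends_on S F -> depends_on S G -> depends_on S (fun s => h (F s) (G s)).
Proof. by move=> dF dG s t st; rewrite (dF _ _ st) (dG _ _ st). Qed.

Lemma depends_on_big S (op : R -> R -> R) (idx : R) (I : finType) (P : pred I)
    (F : I -> {ffun V -> C} -> R) :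
  (forall i, P i -> depends_on S (F i)) ->
  depends_on S (fun s => \big[op/idx]_(i | P i) F i s).
Proof. by move=> dF s t st; apply: eq_bigr => i /dF; apply. Qed.

(** The colour [c0] excludes an empty colour set, for which there may be no colourings and [expect]
    would be 0 on constants. *)
Lemma card_ffun_neq0 (c0 : C) : #|{ffun V -> C}|%:R != 0 :> R.
Proof.
by rewrite pnatr_eq0 -lt0n; apply/card_gt0P; exists [ffun=> c0].
Qed.

Lemma expect_cst (c0 : C) a : expect (fun=> a) = a.
Proof.
rewrite /expect sumr_const -[a *+ _]mulr_natl mulKf//; exact: card_ffun_neq0.
Qed.

(** Exchanging the coordinates outside [S] between two colourings is an involution on pairs. It
    turns [F s * G t] into [F s * G s]: [F] sees only coordinates that stay, [G] only coordinates
    that are exchanged. *)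
Lemma expect_indep (c0 : C) S T F G : [disjoint S & T] -> depends_on S F -> depends_on T G ->
  expect (fun s => F s * G s) = expect F * expect G.
Proof.
move=> ST dF dG.
pose m s t : {ffun V -> C} := [ffun x => if x \in S then s x else t x].
have mm s t : m (m s t) (m t s) = s by apply/ffunP => x; rewrite !ffunE; case: (x \in S).
have N0 := card_ffun_neq0 c0.
suff h : (\sum_s F s) * (\sum_s G s) = #|{ffun V -> C}|%:R * \sum_s F s * G s.
  by rewrite /expect mulrACA h mulrA mulfVK.
rewrite big_distrlr /= pair_bigA /=.
rewrite (reindex (fun p => (m p.1 p.2, m p.2 p.1))) /=; last first.
  by exists (fun p => (m p.1 p.2, m p.2 p.1)) => -[s t] _ /=; rewrite !mm.
rewrite -(pair_bigA _ (fun s t => F (m s t) * G (m t s))) /=.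
transitivity (\sum_s \sum_(t : {ffun V -> C}) F s * G s).
  apply: eq_bigr => s _; apply: eq_bigr => t _; congr (_ * _).
    by apply: dF => x xS; rewrite ffunE xS.
  apply: dG => x xT; rewrite ffunE; case: ifP => // xS.
  by have := disjointFr ST xS; rewrite xT.
by rewrite mulr_sumr; apply: eq_bigr => s _; rewrite sumr_const -[LHS]mulr_natl.
Qed.

Lemma expect_prod (F : V -> C -> R) :
  expect (fun s => \prod_x F x (s x)) = \prod_x (#|C|%:R^-1 * \sum_c F x c).
Proof.
rewrite /expect big_split /= bigA_distr_bigA; congr (_ * _).
by rewrite prodr_const card_ffun natrX exprVn.
Qed.

Lemma expect_cylinder (c0 : C) S (f : V -> C) :
  expect (fun s => \prod_(x in S) (s x == f x)%:R) = #|C|%:R^-1 ^+ #|S|.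
Proof.
pose F x c : R := if x \in S then (c == f x)%:R else 1.
rewrite (@eq_expect _ (fun s => \prod_x F x (s x))); last first.
  by move=> s; rewrite [LHS]big_mkcond.
rewrite expect_prod (bigID (mem S)) /= [X in _ * X]big1 ?mulr1; last first.
  move=> x /negbTE xS; rewrite /F xS sumr_const mulVf// pnatr_eq0 -lt0n.
  by apply/card_gt0P; exists c0.
rewrite -prodr_const; apply: eq_bigr => x xS; rewrite /F xS (bigD1 (f x)) //= eqxx.
by rewrite big1 ?addr0 ?mulr1// => c /negbTE ->.
Qed.

Lemma expect_coord (c0 : C) (h : C -> R) x :
  expect (fun s => h (s x)) = #|C|%:R^-1 * \sum_c h c.
Proof.
pose F y c : R := if y == x then h c else 1.
rewrite (@eq_expect _ (fun s => \prod_y F y (s y))); last first.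
  by move=> s; rewrite (bigD1 x)//= /F eqxx big1 ?mulr1// => y /negbTE ->.
rewrite expect_prod (bigD1 x)//= [X in _ * X]big1 => [|y /negbTE yx].
  by rewrite /F eqxx mulr1.
rewrite /F yx sumr_const mulVf// pnatr_eq0 -lt0n.
by apply/card_gt0P; exists c0.
Qed.

(** First moment method for the measure of density [W]. If [F s < b] everywhere, the nonnegative
    function [(b - F s) * W s] has mean at most 0, so [W] vanishes, against its mean 1. *)
Lemma expect_exists_ge (W F : {ffun V -> C} -> R) b :
  (forall s, 0 <= W s) -> expect W = 1 -> b <= expect (fun s => F s * W s) ->
  exists s, b <= F s.
Proof.
move=> W0 W1 bF; apply/existsP; apply: contraT; rewrite negb_exists => /forallP Fb.
have : expect (fun s => (b - F s) * W s) = b - expect (fun s => F s * W s).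
  by rewrite -[in RHS](mulr1 b) -W1 -expectZ -expectB; apply: eq_expect => s; rewrite mulrBl.
have pos s : 0 <= (b - F s) * W s by rewrite mulr_ge0// subr_ge0 ltW// ltNge Fb.
have e0 : 0 <= expect (fun s => (b - F s) * W s) by apply: expect_ge0.
move=> h; have : expect (fun s => (b - F s) * W s) <= 0 by rewrite h subr_le0.
rewrite /expect; set N := _^-1 => le0.
have : \sum_s W s != 0.
  by apply/negP => /eqP h0; move: W1; rewrite /expect h0 mulr0 => /eqP; rewrite eq_sym oner_eq0.
have N0 : 0 < N.
  rewrite invr_gt0 lt0r ler0n andbT; apply/negP => /eqP h0.
  by move: W1; rewrite /expect h0 invr0 mul0r => /eqP; rewrite eq_sym oner_eq0.
have /eqP : \sum_s (b - F s) * W s = 0.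
  by apply/eqP; rewrite eq_le sumr_ge0// andbT -(pmulr_rle0 _ N0).
rewrite psumr_eq0// => /allP /(_ _ (mem_index_enum _)) az /negP[].
apply/eqP; rewrite big1// => s _; have := az s; rewrite mulf_eq0 subr_eq0 => /orP[|/eqP//].
by move=> /eqP e; have := Fb s; rewrite e lexx.
Qed.

End Expectation.

(** * Characteristic function of the variables [theta (s w)] *)

Section Charfun.
Context {R : realType} {V : finType} {r : nat}.
Local Notation C := 'I_r.+2.
Local Notation E := (@expect R V C).

(** Writing the number of colours as [r.+2] ensures that colours 0 and 1 exist; [r] counts the
    neutral ones. *)
Definition theta (i : C) : R := (val i == 0%N)%:R - (val i == 1%N)%:R.

Lemma theta_cases i : [\/ theta i = 0, theta i = 1 | theta i = -1].
Proof.
rewrite /theta; case: eqP => [->|_] /=; first by rewrite subr0; constructor 2.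
by case: eqP => _; rewrite ?subr0 ?sub0r; [constructor 3|constructor 1].
Qed.

Lemma theta_norm i : `|theta i| <= 1.
Proof. by case: (theta_cases i) => ->; rewrite ?normr0 ?normrN ?normr1. Qed.

Lemma sum_theta_comp (h : R -> R) :
  \sum_i h (theta i) = h 1 + h (-1) + h 0 *+ r.
Proof.
rewrite big_ord_recl big_ord_recl /theta /= subr0 sub0r addrA; congr (_ + _).
under eq_bigr do rewrite subrr.
by rewrite sumr_const card_ord.
Qed.

Lemma expect_theta_comp (h : R -> R) x :
  E (fun s => h (theta (s x))) = r.+2%:R^-1 * (h 1 + h (-1) + h 0 *+ r).
Proof. by rewrite (expect_coord ord0 (fun i => h (theta i))) card_ord sum_theta_comp. Qed.

Lemma expect_theta x : E (fun s => theta (s x)) = 0.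
Proof. by rewrite (expect_theta_comp id) subrr mul0rn addr0 mulr0. Qed.

Lemma expect_theta2 x : E (fun s => theta (s x) ^+ 2) = 2 / r.+2%:R.
Proof.
rewrite (expect_theta_comp (fun z => z ^+ 2)) expr0n mul0rn addr0 sqrrN expr1n.
by rewrite mulrC.
Qed.

(** The characteristic function of [theta] at a uniform colour, real because 1 and -1 are equally
    likely. *)
Definition charf (z : R) : R := 1 - 2 / r.+2%:R * (1 - cos z).

Lemma charf_norm z : `|charf z| <= 1.
Proof.
have r2 : 2 / r.+2%:R <= 1 :> R by rewrite ler_pdivrMr// mul1r ler_nat.
have r0 : 0 <= 2 / r.+2%:R :> R by rewrite divr_ge0.
have c1 := cos_le1 z; have c2 := cos_geN1 z.
have h0 : 0 <= 1 - cos z by lra.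
have := ler_wpM2r h0 r2; have := mulr_ge0 r0 h0; rewrite /charf.
move: (_ / _ * _) => q a b.
by rewrite ler_norml; apply/andP; split; lra.
Qed.

(** Comparison with the Gaussian of the same variance: both functions are [1 - z ^+ 2 / r.+2%:R] up
    to order four. *)
Lemma charf_exp z : `|charf z - expR (- (z ^+ 2 / r.+2%:R))| <= z ^+ 4.
Proof.
set n : R := r.+2%:R.
have n2 : 2 <= n by rewrite ler_nat.
have n0 : 0 < n by lra.
have a := cos_taylor2 z.
have z4 : 0 <= z ^+ 4 by rewrite -[4%N]/(2 * 2)%N exprM sqr_ge0.
have u0 : 0 <= z ^+ 2 / n by rewrite divr_ge0 ?sqr_ge0// ltW.
have b := expRN_taylor1 u0.
have i0 : 0 <= n^-1 by rewrite invr_ge0 ltW.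
have i1 : n^-1 <= 2^-1 by rewrite lef_pV2 ?posrE//; lra.
have -> : charf z - expR (- (z ^+ 2 / n)) =
  - (2 * n^-1 * (1 - cos z - z ^+ 2 / 2)) - (expR (- (z ^+ 2 / n)) - (1 - z ^+ 2 / n)).
  by rewrite /charf -/n; field; lra.
clearbody n; apply: le_trans (ler_normB _ _) _.
rewrite normrN normrM.
have c : `|2 * n^-1| <= 1 by rewrite ger0_norm; lra.
have d : `|2 * n^-1| * `|1 - cos z - z ^+ 2 / 2| <= z ^+ 4 / 8.
  by apply: le_trans a; rewrite ler_piMl.
have e : (z ^+ 2 / n) ^+ 2 <= z ^+ 4 / 4.
  rewrite exprMn -exprM ler_wpM2l//.
  have -> : 4^-1 = (2^-1) ^+ 2 :> R by field.
  by rewrite ler_sqr ?nnegrE// invr_ge0.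
lra.
Qed.

(** Integrates out the coordinate [w]. As [theta] takes only the values 0, 1 and -1, the cosine is
    quadratic in [theta (s w)]; the linear term has mean zero and the square has mean
    [2 / r.+2%:R]. *)
Lemma expect_cos_theta (H phi z : {ffun V -> C} -> R) w :
  depends_on [set~ w] H -> depends_on [set~ w] phi -> depends_on [set~ w] z ->
  E (fun s => H s * cos (phi s + z s * theta (s w))) =
  E (fun s => H s * charf (z s) * cos (phi s)).
Proof.
move=> dH dphi dz.
have dw : [disjoint [set~ w] & [set w]] by rewrite disjoints_subset.
pose K s := H s * cos (phi s) * (1 - cos (z s)); pose L s := H s * sin (phi s) * sin (z s).
have dK : depends_on [set~ w] K.
  by move=> s t st; rewrite /K (dH _ _ st) (dphi _ _ st) (dz _ _ st).
have dL : depends_on [set~ w] L.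
  by move=> s t st; rewrite /L (dH _ _ st) (dphi _ _ st) (dz _ _ st).
have dt h : depends_on [set w] (fun s : {ffun V -> C} => h (theta (s w)) : R).
  by move=> s t st; rewrite (st w) ?set11.
transitivity (E (fun s => H s * cos (phi s) - K s * theta (s w) ^+ 2 - L s * theta (s w))).
  apply: eq_expect => s; rewrite /K /L cosD.
  case: (theta_cases (s w)) => ->.
  - by rewrite mulr0 cos0 sin0; ring.
  - by rewrite mulr1; ring.
  - by rewrite mulrN1 cosN sinN; ring.
rewrite expectB expectB (expect_indep ord0 dw dK (dt (fun x => x ^+ 2))).
rewrite (expect_indep ord0 dw dL (dt id)) expect_theta mulr0 subr0 expect_theta2.
rewrite mulrC -expectZ -expectB; apply: eq_expect => s.
by rewrite /K /charf; ring.
Qed.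

Lemma expect_cos_sum (U : {set V}) (phi : R) (z : V -> {ffun V -> C} -> R) :
  (forall w, w \in U -> depends_on (~: U) (z w)) ->
  E (fun s => cos (phi + \sum_(w in U) z w s * theta (s w))) =
  cos phi * E (fun s => \prod_(w in U) charf (z w s)).
Proof.
move=> dz.
(* The coordinates of [U] are integrated out one at a time; the weight [H] collects the factors
   [charf] already produced, which do not depend on [U]. *)
suff H l : uniq l -> {subset l <= U} -> forall H : {ffun V -> C} -> R,
    depends_on (~: [set x in l]) H ->
    E (fun s => H s * cos (phi + \sum_(w <- l) z w s * theta (s w))) =
    E (fun s => H s * \prod_(w <- l) charf (z w s) * cos phi).
  rewrite -expectZ.
  have := H (enum U) (enum_uniq _) _ (fun=> 1) (fun _ _ _ => erefl).
  move=> h; transitivity (E (fun s => 1 * cos (phi + \sum_(w <- enum U) z w s * theta (s w)))).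
    by apply: eq_expect => s; rewrite mul1r big_enum.
  rewrite h => [|x]; last by rewrite mem_enum.
  by apply: eq_expect => s; rewrite mul1r big_enum mulrC.
elim: l => [_ _ H _|a l IH /= /andP[al ul] lU H dH].
  by apply: eq_expect => s; rewrite !big_nil addr0 mulr1.
have aU : a \in U by apply: lU; rewrite mem_head.
have lU' : {subset l <= U} by move=> x xl; apply: lU; rewrite inE xl orbT.
have da w : w \in U -> depends_on [set~ a] (z w).
  by move=> /dz; apply: depends_onS; rewrite setCS sub1set.
transitivity (E (fun s => H s * charf (z a s) *
    cos (phi + \sum_(w <- l) z w s * theta (s w)))).
  rewrite -(@expect_cos_theta H (fun s => phi + \sum_(w <- l) z w s * theta (s w)) _ a).
  - by apply: eq_expect => s; rewrite big_cons addrA addrAC.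
  - by apply: depends_onS dH; rewrite setCS sub1set inE mem_head.
  - move=> s t st; congr (_ + _); apply: eq_big_seq => w wl.
    rewrite (da _ (lU' _ wl) _ _ st) st// !inE.
    by apply: contraNneq al => <-.
  - exact: da.
rewrite IH//; first by apply: eq_expect => s; rewrite big_cons; ring.
move=> s t st; rewrite (_ : z a s = z a t); last first.
  apply: (dz a aU) => x xU; apply: st; rewrite !inE in xU *.
  by apply: contra xU; apply: lU'.
congr (_ * _); apply: dH => x; rewrite !inE negb_or => /andP[_ xl].
by apply: st; rewrite !inE.
Qed.

End Charfun.

(** * Signals *)

Lemma sum_unique_cases (R : numDomainType) (I : finType) (P : pred I) (F : I -> R) :
  (forall i j, P i -> P j -> i = j) ->
  \sum_(i | P i) F i = 0 \/ exists2 i, P i & \sum_(i | P i) F i = F i.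
Proof.
move=> uP; case: (pickP P) => [i Pi|P0]; last by left; apply: big_pred0.
by right; exists i => //; apply: big_pred1 => j; apply/idP/eqP => [/uP|->//]; apply.
Qed.

Lemma norm_sum_unique (R : numDomainType) (I : finType) (P : pred I) (F : I -> R) (b : R) :
  0 <= b -> (forall i j, P i -> P j -> i = j) -> (forall i, P i -> `|F i| <= b) ->
  `|\sum_(i | P i) F i| <= b.
Proof.
move=> b0 uP Fb; case: (sum_unique_cases F uP) => [->|[i Pi ->]]; last exact: Fb.
by rewrite normr0.
Qed.

Lemma linear_edge_eq (V : finType) (G : {set {set V}}) e1 e2 x y :
  linear_hypergraph G -> e1 \in G -> e2 \in G -> x != y ->
  x \in e1 -> y \in e1 -> x \in e2 -> y \in e2 -> e1 = e2.
Proof.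
move=> lin e1G e2G xy x1 y1 x2 y2; apply/eqP; apply: contraT => /eqP ne.
have := lin _ _ e1G e2G ne; rewrite leqNgt => /negP[]; apply/card_gt1P.
by exists x, y; rewrite !inE x1 y1 x2 y2.
Qed.

Section Signal.
Context {R : realType} {V : finType} {r : nat}.
Local Notation C := 'I_r.+2.
Local Notation E := (@expect R V C).
Implicit Types (e : {set V}) (s : {ffun V -> C}) (G : {set {set V}}).
Variables (typ : V -> nat) (f g : nat -> C) (alpha : R).

Definition apart e := [set a in e | (1 < typ a)%N].

Definition pattern (h : nat -> C) e s : R := \prod_(a in apart e) (s a == h (typ a))%:R.

Definition coef e s : R := pattern f e s - pattern g e s.

(** In a linear hypergraph with [v != w] the sum has at most one term: the coefficient of the edge
    through both vertices, if there is one. *)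
Definition link G v w s : R := \sum_(e in G | (v \in e) && (w \in e)) coef e s.

Definition signal G v s : R := alpha * \sum_(w | typ w == 1%N) link G v w s * theta (s w).

Definition middle e s : R := \sum_(w in e | typ w == 1%N) theta (s w).

(** Grouping by vertices of type 1, as in the definition, is suited to integrating out their
    colours; grouping by edges is suited to splitting off one edge. *)
Lemma signal_edges G v s :
  signal G v s = alpha * \sum_(e in G | v \in e) coef e s * middle e s.
Proof.
congr (_ * _); rewrite /link /middle.
under eq_bigr do rewrite mulr_suml.
rewrite (exchange_big_dep (fun e => (e \in G) && (v \in e))) /=; last first.
  by move=> w e _ /and3P[-> ->].
apply: eq_bigr => e /andP[eG ve]; rewrite mulr_sumr; apply: eq_bigl => w.
by rewrite eG ve /= andbC.
Qed.

Lemma pattern_cases h e s : pattern h e s = 0 \/ pattern h e s = 1.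
Proof.
rewrite /pattern; elim/big_rec : _ => [|a x _ [] ->]; first by right.
  by left; rewrite mulr0.
by case: (_ == _); rewrite ?mul1r ?mul0r; [right|left].
Qed.

Lemma coef_cases e s : [\/ coef e s = 0, coef e s = 1 | coef e s = -1].
Proof.
rewrite /coef; case: (pattern_cases f e s) => ->; case: (pattern_cases g e s) => ->.
- by rewrite subr0; constructor 1.
- by rewrite sub0r; constructor 3.
- by rewrite subr0; constructor 2.
- by rewrite subrr; constructor 1.
Qed.

Lemma coef_norm e s : `|coef e s| <= 1.
Proof. by case: (coef_cases e s) => ->; rewrite ?normr0 ?normrN ?normr1. Qed.

Lemma pattern_dep h e : depends_on (apart e) (pattern h e).
Proof. by move=> s t st; apply: eq_bigr => a ae; rewrite st. Qed.

Lemma coef_dep e : depends_on (apart e) (coef e).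
Proof. by move=> s t st; rewrite /coef !(pattern_dep _ st). Qed.

(** Both patterns prescribe colours on the same vertices, so they are equally likely. *)
Lemma expect_coef e : E (coef e) = 0.
Proof.
by rewrite expectB !(expect_cylinder ord0 _ (fun a => _ (typ a))) subrr.
Qed.

Section Fixed.
Variables (k : nat) (D : R) (G : {set {set V}}).
Hypothesis Glin : linear_hypergraph G.
Hypothesis Gk : forall e, e \in G -> (#|e| <= k)%N.
Hypothesis Ginj : forall e, e \in G -> {in e &, injective typ}.
Hypothesis Gdeg : forall v, typ v = 0%N -> #|[set e in G | v \in e]|%:R <= D.

Lemma same_type_notin e u v : e \in G -> typ u = typ v -> u != v -> u \in e -> v \notin e.
Proof. by move=> eG tuv uv ue; apply: contra uv => ve; apply/eqP/(Ginj eG). Qed.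

Lemma sum_deg v : typ v = 0%N -> \sum_(e in G | v \in e) 1 <= D :> R.
Proof.
move=> /Gdeg; apply: le_trans; rewrite -sum1_card natr_sum.
by rewrite le_eqVlt; apply/orP; left; apply/eqP; apply: eq_bigl => e; rewrite inE.
Qed.

Lemma type1_unique e w w' : e \in G ->
  (w \in e) && (typ w == 1%N) -> (w' \in e) && (typ w' == 1%N) -> w = w'.
Proof.
by move=> eG /andP[we /eqP tw] /andP[we' /eqP tw']; apply: (Ginj eG) => //; rewrite tw.
Qed.

Lemma middle_cases e s : e \in G ->
  [\/ middle e s = 0, middle e s = 1 | middle e s = -1].
Proof.
move=> eG; rewrite /middle.
have [] := @sum_unique_cases R _ (fun w => (w \in e) && (typ w == 1%N))
  (fun w => theta (s w)).
- by move=> w w'; apply: type1_unique eG.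
- by move=> ->; constructor 1.
- by move=> [w _ ->]; apply: theta_cases.
Qed.

Lemma link_norm v w s : v != w -> `|link G v w s| <= 1.
Proof.
move=> vw; apply: norm_sum_unique => // [e1 e2|e _]; last exact: coef_norm.
move=> /and3P[e1G v1 w1] /and3P[e2G v2 w2].
exact: (linear_edge_eq Glin e1G e2G vw).
Qed.

Lemma sum_type1_le (x : R) e : e \in G -> 0 <= x ->
  \sum_(w in e | typ w == 1%N) x <= x.
Proof.
move=> eG x0; apply: le_trans (ler_norm _) _; apply: norm_sum_unique => //.
  by move=> w w'; apply: type1_unique eG.
by move=> w _; rewrite ger0_norm.
Qed.

Lemma sum_link v s : typ v = 0%N -> \sum_(w | typ w == 1%N) `|link G v w s| <= D.
Proof.
move=> tv; apply: le_trans (sum_deg tv).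
apply: (@le_trans _ _ (\sum_(w | typ w == 1%N) \sum_(e in G | (v \in e) && (w \in e)) 1)).
  apply: ler_sum => w _; apply: le_trans (ler_norm_sum _ _ _) _.
  by apply: ler_sum => e _; apply: coef_norm.
rewrite (exchange_big_dep (fun e => (e \in G) && (v \in e))) /=; last first.
  by move=> w e _ /and3P[-> ->].
apply: ler_sum => e /andP[eG ve].
rewrite (eq_bigl (fun w => (w \in e) && (typ w == 1%N))) => [|w].
  by apply: sum_type1_le.
by rewrite eG ve andbC.
Qed.

Lemma link_dep (S : {set V}) v w :
  (forall e, e \in G -> v \in e -> w \in e -> apart e \subset S) ->
  depends_on S (link G v w).
Proof.
move=> eS; apply: depends_on_big => e /and3P[eG ve we].
exact: depends_onS (eS _ eG ve we) (@coef_dep e).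
Qed.

(** Inner product of the coefficients of two signals, up to the factor [alpha ^+ 2]; its smallness
    is their near orthogonality. *)
Definition corr u v s : R := \sum_(w | typ w == 1%N) link G u w s * link G v w s.

(* Only pairs (w, w') for which the edges through {u, w} and {v, w'} meet can
   contribute to the second moment, and linearity leaves at most k D of them. *)
Lemma expect_link4 u v w w' : u != v ->
  typ u = 0%N -> typ v = 0%N -> typ w = 1%N -> typ w' = 1%N ->
  E (fun s => (link G u w s * link G v w s) * (link G u w' s * link G v w' s)) <=
  \sum_(e1 in G | (u \in e1) && (w \in e1)) \sum_(e2 in G | (v \in e2) && (w' \in e2))
    (e1 :&: e2 != set0)%:R.
Proof.
move=> uv tu tv tw tw'.
have ne01 x y : typ x = 0%N -> typ y = 1%N -> x != y.
  by move=> tx ty; apply/eqP => xy; move: ty; rewrite -xy tx.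
pose H s := link G v w s * link G u w' s.
have -> : E (fun s => (link G u w s * link G v w s) * (link G u w' s * link G v w' s)) =
    \sum_(e1 in G | (u \in e1) && (w \in e1)) \sum_(e2 in G | (v \in e2) && (w' \in e2))
      E (fun s => coef e1 s * (coef e2 s * H s)).
  under [RHS]eq_bigr do rewrite -expect_sum.
  rewrite -expect_sum; apply: eq_expect => s.
  under [RHS]eq_bigr do rewrite -mulr_sumr -mulr_suml.
  by rewrite -mulr_suml -/(link G u w s) -/(link G v w' s) /H; ring.
apply: ler_sum => e1 /and3P[e1G ue1 we1]; apply: ler_sum => e2 /and3P[e2G ve2 we2].
have ve1 : v \notin e1 by apply: same_type_notin ue1; rewrite ?tu.
case: eqP => [dis|_] /=; last first.
  apply: le_trans (ler_norm _) _; apply: le_trans (ler_norm_expect _) _.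
  rewrite -[leRHS](expect_cst ord0 (V := V) (C := C)); apply: ler_expect => s.
  rewrite !normrM mulr_ile1 ?coef_norm// ?mulr_ge0// mulr_ile1 ?coef_norm ?mulr_ge0//.
  by rewrite mulr_ile1// link_norm// ne01.
(* For disjoint [e1] and [e2], nothing else in the product sees [apart e1]. An edge through [v] and
   [w] meeting it would be [e1], which misses [v]; an edge through [u] and [w'] meeting it would be
   [e1], and then [w = w'] would lie in both [e1] and [e2]. *)
have d12 : [disjoint apart e1 & ~: apart e1] by rewrite disjoints_subset setCK.
rewrite (expect_indep ord0 d12 (@coef_dep e1)) ?expect_coef ?mul0r//.
apply: depends_on_comp2; last apply: depends_on_comp2.
- apply: depends_onS (@coef_dep e2); apply/subsetP => a; rewrite !inE.
  move=> /andP[ae2 _]; apply/negP => /andP[ae1 _].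
  by have := in_set0 a; rewrite -dis inE ae1 ae2.
- apply: link_dep => e eG ve we; apply/subsetP => a; rewrite !inE.
  move=> /andP[ae ta]; apply/negP => /andP[ae1 _].
  have aw : a != w by apply: contraTneq ta => ->; rewrite tw.
  by move: ve1; rewrite -(linear_edge_eq Glin eG e1G aw) ?ve.
apply: link_dep => e eG ue we; apply/subsetP => a; rewrite !inE.
move=> /andP[ae ta]; apply/negP => /andP[ae1 _].
have au : a != u by apply: contraTneq ta => ->; rewrite tu.
have ee1 := linear_edge_eq Glin eG e1G au ae ue ae1 ue1.
have ww' : w = w' by apply: (Ginj e1G); rewrite -?ee1// ?ee1// tw tw'.
by have := in_set0 w; rewrite -dis inE we1 ww' we2.
Qed.

Lemma expect_corr2 u v : u != v -> typ u = 0%N -> typ v = 0%N ->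
  E (fun s => corr u v s ^+ 2) <= k%:R * D.
Proof.
move=> uv tu tv.
have -> : E (fun s => corr u v s ^+ 2) =
    \sum_(w | typ w == 1%N) \sum_(w' | typ w' == 1%N)
      E (fun s => (link G u w s * link G v w s) * (link G u w' s * link G v w' s)).
  under [RHS]eq_bigr do rewrite -expect_sum.
  rewrite -expect_sum; apply: eq_expect => s.
  under [RHS]eq_bigr do rewrite -mulr_sumr.
  by rewrite -mulr_suml -expr2.
apply: (@le_trans _ _ (\sum_(w | typ w == 1%N) \sum_(w' | typ w' == 1%N)
    \sum_(e1 in G | (u \in e1) && (w \in e1)) \sum_(e2 in G | (v \in e2) && (w' \in e2))
    (e1 :&: e2 != set0)%:R)).
  apply: ler_sum => w /eqP tw; apply: ler_sum => w' /eqP tw'.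
  exact: expect_link4.
pose I e1 e2 : R := (e1 :&: e2 != set0)%:R.
have I01 e1 e2 : 0 <= I e1 e2 <= 1 by rewrite ler0n lern1 leq_b1.
apply: (@le_trans _ _ (\sum_(e1 in G | u \in e1) \sum_(w in e1 | typ w == 1%N)
    \sum_(e2 in G | v \in e2) \sum_(w' in e2 | typ w' == 1%N) I e1 e2)).
  rewrite le_eqVlt; apply/orP; left; apply/eqP.
  transitivity (\sum_(w | typ w == 1%N) \sum_(e1 in G | (u \in e1) && (w \in e1))
      \sum_(e2 in G | v \in e2) \sum_(w' in e2 | typ w' == 1%N) I e1 e2).
    apply: eq_bigr => w _; rewrite exchange_big; apply: eq_bigr => e1 _.
    rewrite (exchange_big_dep (fun e => (e \in G) && (v \in e))) /=; last first.
      by move=> w' e _ /and3P[-> ->].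
    apply: eq_bigr => e2 /andP[e2G ve2]; apply: eq_bigl => w'.
    by rewrite e2G ve2 andbC.
  rewrite (exchange_big_dep (fun e => (e \in G) && (u \in e))) /=; last first.
    by move=> w e _ /and3P[-> ->].
  apply: eq_bigr => e1 /andP[e1G ue1]; apply: eq_bigl => w.
  by rewrite e1G ue1 andbC.
apply: (@le_trans _ _ (\sum_(e1 in G | u \in e1) k%:R)); last first.
  have := ler_wpM2l (ler0n R k) (sum_deg tu); apply: le_trans.
  by rewrite mulr_sumr; under [leRHS]eq_bigr do rewrite mulr1.
apply: ler_sum => e1 /andP[e1G ue1].
have ve1 : v \notin e1 by apply: same_type_notin ue1; rewrite ?tu.
apply: (@le_trans _ _ (\sum_(e2 in G | v \in e2) I e1 e2)).
  apply: (@le_trans _ _ (\sum_(w in e1 | typ w == 1%N) \sum_(e2 in G | v \in e2) I e1 e2)).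
    apply: ler_sum => w _; apply: ler_sum => e2 /andP[e2G _].
    by apply: sum_type1_le => //; case/andP: (I01 e1 e2).
  by apply: sum_type1_le => //; apply: sumr_ge0 => e2 _; case/andP: (I01 e1 e2).
(* An intersection is charged to a common vertex [a]. As [v] is not in [e1], linearity leaves at
   most one [e2] through [v] and [a], hence at most [k] edges [e2] for each [e1]. *)
apply: (@le_trans _ _ (\sum_(e2 in G | v \in e2) \sum_(a in e1) (a \in e2)%:R)).
  apply: ler_sum => e2 _; rewrite /I; case: set0Pn => [[a]|_] /=; last exact: sumr_ge0.
  rewrite inE => /andP[a1 a2]; rewrite (bigD1 a)//= a2 lerDl.
  by apply: sumr_ge0.
rewrite exchange_big /=; apply: (@le_trans _ _ (\sum_(a in e1) 1)); last first.
  by rewrite sumr_const ler_nat Gk.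
apply: ler_sum => a ae1.
rewrite (eq_bigr (fun e2 => if a \in e2 then 1 else 0)) => [|e2 _];
  last by case: (_ \in _).
rewrite -big_mkcondr /=; apply: le_trans (ler_norm _) _; apply: norm_sum_unique => //.
  have va : v != a by apply: contraNneq ve1 => ->.
  move=> e2 e3 /andP[/andP[e2G v2] a2] /andP[/andP[e3G v3] a3].
  exact: (linear_edge_eq Glin e2G e3G va v2 a2 v3 a3).
by move=> *; rewrite normr1.
Qed.

Hypothesis alpha01 : 0 <= alpha <= 1.
Hypothesis alphaD : alpha ^+ 2 * D <= 1.

(** For [x] the absolute correlation, [alpha * (alpha * x - 1) ^+ 2 >= 0] bounds [alpha ^+ 2 * x] by
    the average of [alpha ^+ 3 * x ^+ 2] and [alpha]. The second moment is of order [D], which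
    [alpha ^+ 2] absorbs. *)
Lemma expect_norm_corr u v : (0 < k)%N -> u != v -> typ u = 0%N -> typ v = 0%N ->
  alpha ^+ 2 * E (fun s => `|corr u v s|) <= k%:R * alpha.
Proof.
move=> k0 uv tu tv; case/andP: alpha01 => a0 a1.
have k1 : 1 <= k%:R :> R by rewrite ler1n.
rewrite -expectZ.
apply: (@le_trans _ _ (E (fun s => 2^-1 * (alpha ^+ 3 * corr u v s ^+ 2 + alpha)))).
  apply: ler_expect => s; have := mulr_ge0 a0 (sqr_ge0 (alpha * `|corr u v s| - 1)).
  rewrite -[corr u v s ^+ 2]real_normK ?num_real//.
  by move: `|_| => x h; nra.
rewrite expectZ expectD expectZ (expect_cst ord0).
have h : alpha ^+ 3 * E (fun s => corr u v s ^+ 2) <= alpha * k%:R.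
  apply: le_trans (ler_wpM2l _ (expect_corr2 uv tu tv)) _; first exact: exprn_ge0.
  rewrite [leLHS](_ : _ = (alpha * k%:R) * (alpha ^+ 2 * D)); last by ring.
  by rewrite ler_piMr// mulr_ge0.
have : alpha * 1 <= alpha * k%:R by rewrite ler_wpM2l.
lra.
Qed.

(** Three of the four inner sums are bounded by [k]; the fourth, summed over [w], gives at most [D]
    per vertex of [T]. Two powers of [alpha] absorb [D]. *)
Lemma sum_fourth_power (T : {set V}) (eps : V -> R) s :
  (forall v, v \in T -> typ v = 0%N) -> (#|T| <= k)%N ->
  (forall v, v \in T -> `|eps v| = 1) ->
  \sum_(w | typ w == 1%N) (alpha * \sum_(v in T) eps v * link G v w s) ^+ 4 <=
  k%:R ^+ 4 * alpha.
Proof.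
move=> T0 Tk eps1; case/andP: alpha01 => a0 a1.
have ne01 x y : typ x = 0%N -> typ y = 1%N -> x != y.
  by move=> tx ty; apply/eqP => xy; move: ty; rewrite -xy tx.
apply: (@le_trans _ _ (\sum_(w | typ w == 1%N)
    alpha ^+ 4 * (k%:R ^+ 3 * \sum_(v in T) `|link G v w s|))).
  apply: ler_sum => w /eqP tw; rewrite exprMn ler_wpM2l ?exprn_ge0//.
  set x := \sum_(v in T) _; set y := \sum_(v in T) _.
  have xy : `|x| <= y.
    apply: le_trans (ler_norm_sum _ _ _) _; apply: ler_sum => v vT.
    by rewrite normrM eps1// mul1r.
  have yk : y <= k%:R.
    apply: (@le_trans _ _ (\sum_(v in T) 1)); last by rewrite sumr_const ler_nat.
    by apply: ler_sum => v vT; rewrite link_norm// ne01// T0.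
  rewrite (_ : x ^+ 4 = `|x| ^+ 3 * `|x|); last first.
    by rewrite -exprSr -[4%N]/(2 * 2)%N !exprM real_normK ?num_real.
  rewrite ler_pM ?exprn_ge0// ler_pXn2r ?nnegrE//; exact: le_trans yk.
rewrite -mulr_sumr -mulr_sumr exchange_big /=.
apply: (@le_trans _ _ (alpha ^+ 4 * (k%:R ^+ 3 * \sum_(v in T) D))).
  rewrite ler_wpM2l ?exprn_ge0// ler_wpM2l ?exprn_ge0//.
  by apply: ler_sum => v /T0; apply: sum_link.
rewrite sumr_const -[D *+ _]mulr_natl.
have [T00|/card_gt0P [v /T0 tv]] := posnP #|T|.
  by rewrite T00 mul0r !mulr0 mulr_ge0 ?exprn_ge0.
have D0 : 0 <= D by apply: le_trans (Gdeg tv).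
rewrite [leLHS](_ : _ = (k%:R ^+ 3 * #|T|%:R) * alpha ^+ 2 * (alpha ^+ 2 * D)); last by ring.
apply: (@le_trans _ _ ((k%:R ^+ 3 * #|T|%:R) * alpha ^+ 2)).
  by rewrite ler_piMr// !mulr_ge0 ?exprn_ge0.
rewrite ler_pM ?mulr_ge0 ?exprn_ge0//; first by rewrite [leRHS]exprSr ler_wpM2l ?exprn_ge0 ?ler_nat.
by rewrite expr2 ler_piMl.
Qed.

(** Diagonal part of the sum of squared coefficients of a signed combination of signals; it is the
    same for all signs. *)
Definition energy (T : {set V}) s : R :=
  \sum_(w | typ w == 1%N) \sum_(v in T) link G v w s ^+ 2.

Lemma sum_square_expand (T : {set V}) (eps : V -> R) s :
  (forall v, v \in T -> `|eps v| = 1) ->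
  \sum_(w | typ w == 1%N) (alpha * \sum_(v in T) eps v * link G v w s) ^+ 2 =
  alpha ^+ 2 * energy T s + alpha ^+ 2 *
    \sum_(u in T) \sum_(v in T | v != u) eps u * eps v * corr u v s.
Proof.
move=> eps1; rewrite -mulrDr /corr.
under [X in _ + X]eq_bigr do under eq_bigr do rewrite mulr_sumr.
under [X in _ + X]eq_bigr do rewrite exchange_big.
rewrite exchange_big -big_split /= mulr_sumr; apply: eq_bigr => w _.
rewrite exprMn; congr (_ * _); rewrite expr2 mulr_suml -big_split /=.
apply: eq_bigr => u uT; rewrite (bigD1 u)//= mulrDr; congr (_ + _).
  by rewrite mulrACA -expr2 -[eps u ^+ 2]real_normK ?num_real// eps1// expr1n mul1r.
by rewrite mulr_sumr; apply: eq_bigr => v _; ring.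
Qed.

(** Integrating out the vertices of type 1 gives a product of values of [charf]. At a cost of order
    [alpha], these become Gaussian factors and the off-diagonal correlations are dropped from the
    exponent; the main term is then free of the signs [eps]. *)
Lemma expect_cos_signals (T : {set V}) (eps : V -> R) (phi : R) : (0 < k)%N ->
  (forall v, v \in T -> typ v = 0%N) -> (#|T| <= k)%N ->
  (forall v, v \in T -> `|eps v| = 1) ->
  `|E (fun s => cos (phi + \sum_(v in T) eps v * signal G v s)) -
    cos phi * E (fun s => expR (- (alpha ^+ 2 / r.+2%:R * energy T s)))|
  <= 2 * k%:R ^+ 4 * alpha.
Proof.
move=> k0 T0 Tk eps1; case/andP: alpha01 => a0 a1.
pose z w s := alpha * \sum_(v in T) eps v * link G v w s.
pose U := [set w | typ w == 1%N].
have -> : E (fun s => cos (phi + \sum_(v in T) eps v * signal G v s)) =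
    E (fun s => cos (phi + \sum_(w in U) z w s * theta (s w))).
  apply: eq_expect => s; congr (cos (_ + _)); rewrite /signal.
  under eq_bigr do rewrite mulrCA mulr_sumr.
  rewrite -mulr_sumr exchange_big mulr_sumr /=; apply: eq_big => [w|w _].
    by rewrite inE.
  rewrite /z -mulrA mulr_suml; congr (_ * _); apply: eq_bigr => v _.
  by rewrite mulrA.
rewrite expect_cos_sum => [|w _]; last first.
  apply: depends_on_comp; apply: depends_on_big => v _; apply: depends_on_comp.
  apply: link_dep => e _ _ _; apply/subsetP => a; rewrite !inE => /andP[_].
  by apply: contraTneq => ->.
rewrite -mulrBr normrM -expectB.
apply: le_trans (ler_piMl _ (cos_max _)) _ => //.
apply: le_trans (ler_norm_expect _) _.
apply: (@le_trans _ _ (E (fun s => k%:R ^+ 4 * alpha +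
    \sum_(u in T) \sum_(v in T | v != u) alpha ^+ 2 * `|corr u v s|))).
  apply: ler_expect => s.
  pose Q := \prod_(w in U) expR (- (z w s ^+ 2 / r.+2%:R)).
  apply: le_trans (ler_distD Q _ _) _; apply: lerD.
    apply: (@le_trans _ _ (\sum_(w in U) z w s ^+ 4)).
      apply: le_trans (ler_norm_prodB _ _ _) _ => [w _|w _|].
      - exact: charf_norm.
      - by rewrite ger0_norm ?expR_ge0// -[leRHS]expR0 ler_expR oppr_le0 divr_ge0 ?sqr_ge0.
      by apply: ler_sum => w _; apply: charf_exp.
    rewrite (eq_bigl (fun w => typ w == 1%N)) => [|w]; last by rewrite inE.
    exact: sum_fourth_power.
  rewrite /Q -expR_sum sumrN -mulr_suml.
  have i0 : 0 <= r.+2%:R^-1 :> R by rewrite invr_ge0.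
  have i1 : r.+2%:R^-1 <= 1 :> R by rewrite invf_le1// ler1n.
  apply: le_trans (expRN_lipschitz _ _) _.
  - by rewrite mulr_ge0// sumr_ge0// => w _; apply: sqr_ge0.
  - rewrite !mulr_ge0// ?sqr_ge0// sumr_ge0// => w _; apply: sumr_ge0 => v _.
    exact: sqr_ge0.
  rewrite (eq_bigl (fun w => typ w == 1%N)) => [|w]; last by rewrite inE.
  rewrite sum_square_expand// mulrDl mulrAC addrAC subrr add0r.
  rewrite normrM (ger0_norm i0) normrM (ger0_norm (sqr_ge0 alpha)).
  apply: le_trans (ler_piMr _ i1) _; first by rewrite mulr_ge0 ?sqr_ge0.
  apply: le_trans (ler_wpM2l (sqr_ge0 _) (ler_norm_sum _ _ _)) _.
  rewrite mulr_sumr; apply: ler_sum => u uT; rewrite -mulr_sumr ler_wpM2l ?sqr_ge0//.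
  apply: le_trans (ler_norm_sum _ _ _) _; apply: ler_sum => v /andP[vT _].
  by rewrite !normrM !eps1// !mul1r.
rewrite expectD (expect_cst ord0) expect_sum.
rewrite -mulrA mulr_natl mulr2n lerD2l.
have k1 : 1 <= k%:R :> R by rewrite ler1n.
apply: (@le_trans _ _ (\sum_(u in T) \sum_(v in T) k%:R * alpha)).
  apply: ler_sum => u uT; rewrite expect_sum [leRHS](bigID (fun v => v != u)) /=.
  rewrite -[leLHS]addr0 lerD//; last by apply: sumr_ge0 => v _; apply: mulr_ge0.
  apply: ler_sum => v /andP[vT vu]; rewrite expectZ expect_norm_corr ?T0//.
  by rewrite eq_sym.
rewrite !sumr_const -[leLHS]mulr_natl -[k%:R * alpha *+ _]mulr_natl.
have -> : k%:R ^+ 4 * alpha = k%:R * (k%:R * (k%:R * (k%:R * alpha))) by ring.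
have ka : 0 <= k%:R * alpha by rewrite mulr_ge0.
have Tk' : #|T|%:R <= k%:R :> R by rewrite ler_nat.
rewrite ler_pM ?mulr_ge0// ler_pM ?mulr_ge0//.
by rewrite ler_peMl.
Qed.

(** A sine is a cosine with phase [- (pi / 2)], and [expect_cos_sum] extracts the factor
    [cos (- (pi / 2))], which is 0. *)
Lemma expect_sin_signal v : typ v = 0%N -> E (fun s => sin (signal G v s)) = 0.
Proof.
move=> tv; pose U := [set w | typ w == 1%N].
pose z w s := alpha * link G v w s.
have -> : E (fun s => sin (signal G v s)) =
    E (fun s => cos (- (pi / 2) + \sum_(w in U) z w s * theta (s w))).
  apply: eq_expect => s; rewrite addrC cosBpihalf; congr (sin _).
  rewrite /signal mulr_sumr; apply: eq_big => [w|w _]; first by rewrite inE.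
  by rewrite mulrA.
rewrite expect_cos_sum ?cosN ?cos_pihalf ?mul0r// => w _.
apply: depends_on_comp.
apply: link_dep => e _ _ _; apply/subsetP => a; rewrite !inE => /andP[_].
by apply: contraTneq => ->.
Qed.

Lemma expect_prod_sin (T : {set V}) : (0 < k)%N -> T != set0 ->
  (forall v, v \in T -> typ v = 0%N) -> (#|T| <= k)%N ->
  `|E (fun s => \prod_(v in T) sin (signal G v s))| <= 2 * k%:R ^+ 4 * alpha.
Proof.
move=> k0 Tn T0 Tk.
pose H := E (fun s => expR (- (alpha ^+ 2 / r.+2%:R * energy T s))).
(* Product-to-sum formulas: the vertices in [l] still contribute sines, the others have moved into
   the cosine. The main term [cos phi * H] occurs only for empty [l], because the half-difference
   made by a sine compares two cosines with the same phase and so cancels it. *)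
suff main l : uniq l -> {subset l <= T} -> forall (eps : V -> R) phi,
    (forall v, v \in T -> `|eps v| = 1) ->
    `|E (fun s => cos (phi + \sum_(v in T | v \notin l) eps v * signal G v s) *
          \prod_(v <- l) sin (signal G v s)) - (l == [::])%:R * (cos phi * H)|
    <= 2 * k%:R ^+ 4 * alpha.
  have -> : E (fun s => \prod_(v in T) sin (signal G v s)) =
      E (fun s => cos (0 + \sum_(v in T | v \notin enum T) 1 * signal G v s) *
          \prod_(v <- enum T) sin (signal G v s)).
    apply: eq_expect => s; rewrite big_enum [\sum_(v in T | _) _]big_pred0 => [|v].
      by rewrite addr0 cos0 mul1r.
    by rewrite mem_enum andbN.
  have := main (enum T) (enum_uniq _) _ (fun=> 1) 0 _.
  have -> : (enum T == [::]) = false.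
    by apply: contraNF Tn => /eqP h; rewrite -cards_eq0 cardE h.
  rewrite mul0r subr0; apply=> [v|v _]; first by rewrite mem_enum.
  exact: normr1.
elim: l => [_ _ eps phi eps1|a l IH /= /andP[al ul] lT eps phi eps1].
  rewrite eqxx mul1r.
  have -> : E (fun s => cos (phi + \sum_(v in T | v \notin [::]) eps v * signal G v s) *
      \prod_(v <- [::]) sin (signal G v s)) =
      E (fun s => cos (phi + \sum_(v in T) eps v * signal G v s)).
    apply: eq_expect => s; rewrite big_nil mulr1; congr (cos (_ + _)).
    by apply: eq_bigl => v; rewrite andbT.
  exact: expect_cos_signals.
have aT : a \in T by apply: lT; rewrite mem_head.
pose ep (x : R) v := if v == a then x else eps v.
have ep1 x : `|x| = 1 -> forall v, v \in T -> `|ep x v| = 1.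
  by move=> x1 v vT; rewrite /ep; case: eqP => // _; apply: eps1.
have lT' : {subset l <= T} by move=> x xl; apply: lT; rewrite inE xl orbT.
pose A x := E (fun s => cos (phi - pi / 2 + \sum_(v in T | v \notin l) ep x v * signal G v s) *
          \prod_(v <- l) sin (signal G v s)).
have -> : E (fun s => cos (phi + \sum_(v in T | v \notin a :: l) eps v * signal G v s) *
          \prod_(v <- a :: l) sin (signal G v s)) = 2^-1 * (A 1 - A (-1)).
  rewrite /A -expectB -expectZ; apply: eq_expect => s; rewrite big_cons.
  have sp x : \sum_(v in T | v \notin l) ep x v * signal G v s =
      x * signal G a s + \sum_(v in T | v \notin a :: l) eps v * signal G v s.
    rewrite (bigD1 a) ?aT//= /ep eqxx; congr (_ + _); apply: eq_big => [v|v].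
      by rewrite inE negb_or; case: (v == a); rewrite ?andbT ?andbF.
    by move=> /andP[_ /negbTE ->].
  rewrite !sp mul1r mulN1r.
  set Z := \sum_(v in T | _) _; set sa := signal G a s; set P := \prod_(v <- l) _.
  have -> : phi - pi / 2 + (sa + Z) = (phi + Z + sa) - pi / 2 by ring.
  have -> : phi - pi / 2 + (- sa + Z) = (phi + Z - sa) - pi / 2 by ring.
  by rewrite !cosBpihalf sinD sinB; field.
rewrite mul0r subr0.
have h1 := IH ul lT' (ep 1) (phi - pi / 2) (ep1 1 (normr1 _)).
have N1 : `|-1| = 1 :> R by rewrite normrN normr1.
have h2 := IH ul lT' (ep (-1)) (phi - pi / 2) (ep1 (-1) N1).
rewrite -/(A _) in h1; rewrite -/(A _) in h2.
move: h1 h2; set b := _ * (_ * H); set d := 2 * _ * _ => h1 h2.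
have -> : 2^-1 * (A 1 - A (-1)) = 2^-1 * ((A 1 - b) - (A (-1) - b)) by ring.
rewrite normrM ger0_norm ?invr_ge0//.
by have := ler_normB (A 1 - b) (A (-1) - b); lra.
Qed.

Lemma signal_dep (S : {set V}) v :
  (forall e, e \in G -> v \in e -> [set x in e | (0 < typ x)%N] \subset S) ->
  depends_on S (signal G v).
Proof.
move=> GS s t st; rewrite !signal_edges; congr (_ * _).
apply: eq_bigr => e /andP[eG ve]; have /subsetP eS := GS _ eG ve; congr (_ * _).
  apply: coef_dep => a; rewrite inE => /andP[ae ta]; apply/st/eS.
  by rewrite inE ae (ltn_trans _ ta).
by apply: eq_bigr => w /andP[we /eqP tw]; rewrite st// eS// inE we tw.
Qed.

(** Two edges of [G] through [v] share only [v], so their contributions are independent with mean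
    zero, and the second moment of the signal is at most [alpha ^+ 2 * D]. Then [cos_ge] applies. *)
Lemma expect_cos_signal v : typ v = 0%N -> 2^-1 <= E (fun s => cos (signal G v s)).
Proof.
move=> tv; case/andP: alpha01 => a0 a1.
pose q e s := coef e s * middle e s.
have q_dep e : e \in G -> depends_on [set x in e | (0 < typ x)%N] (q e).
  move=> eG; apply: depends_on_comp2.
    apply: depends_onS (@coef_dep e); apply/subsetP => a; rewrite !inE.
    by move=> /andP[-> /ltnW].
  by move=> s t st; apply: eq_bigr => w /andP[we /eqP tw]; rewrite st// inE we tw.
have q0 e : E (q e) = 0.
  rewrite (@expect_indep _ _ _ ord0 (apart e) [set w | typ w == 1%N]).
  - by rewrite expect_coef mul0r.
  - rewrite -setI_eq0; apply/eqP/setP => a; rewrite !inE.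
    by case: eqP => [->|]; rewrite ?andbF.
  - exact: coef_dep.
  by move=> s t st; apply: eq_bigr => w /andP[we tw]; rewrite st// inE.
have q2 : E (fun s => signal G v s ^+ 2) <= 1.
  have -> : E (fun s => signal G v s ^+ 2) = alpha ^+ 2 *
      \sum_(e1 in G | v \in e1) \sum_(e2 in G | v \in e2) E (fun s => q e1 s * q e2 s).
    under eq_bigr do rewrite -expect_sum.
    rewrite -expect_sum -expectZ; apply: eq_expect => s.
    rewrite signal_edges exprMn; congr (_ * _).
    under [RHS]eq_bigr do rewrite -mulr_sumr.
    by rewrite -mulr_suml expr2.
  apply: le_trans alphaD; rewrite ler_wpM2l ?sqr_ge0//.
  apply: le_trans (sum_deg tv); apply: ler_sum => e1 /andP[e1G v1].
  rewrite (bigD1 e1) ?e1G//= big1 ?addr0 => [|e2 /andP[/andP[e2G v2] e21]].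
    rewrite -[leRHS](expect_cst ord0 (V := V) (C := C)); apply: ler_expect => s.
    rewrite /q; case: (coef_cases e1 s) => ->; case: (middle_cases s e1G) => ->;
      rewrite ?mul0r ?mulr0 ?mul1r ?mulN1r ?opprK ?mulrN1 ?opprK ?mulr1 ?ler01 ?lexx//.
  rewrite (expect_indep ord0 _ (q_dep _ e1G) (q_dep _ e2G)) ?q0 ?mul0r//.
  rewrite -setI_eq0; apply/eqP/setP => a; rewrite !inE; apply/negP.
  move=> /andP[/andP[a1' ta] /andP[a2' _]].
  have av : a != v by apply: contraTneq ta => ->; rewrite tv.
  by move/eqP: e21; apply; apply: (linear_edge_eq Glin e2G e1G av).
apply: (@le_trans _ _ (E (fun s => 1 - 2^-1 * signal G v s ^+ 2))).
  by rewrite expectB expectZ (expect_cst ord0); lra.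
by apply: ler_expect => s; rewrite mulrC; apply: cos_ge.
Qed.

End Fixed.

Lemma linear_sub G G' : G' \subset G -> linear_hypergraph G -> linear_hypergraph G'.
Proof. by move=> /subsetP sG lin e1 e2 /sG h1 /sG h2; apply: lin. Qed.

(** The signal is [alpha * q] from the edge [e] plus a remainder that ignores the colours on [e]. In
    the addition formula the sine of the remainder has mean zero, and its cosine has mean at least
    1/2. *)
Lemma expect_mul_sin_signal (D : R) G e v (h : {ffun V -> C} -> R) :
  linear_hypergraph G -> (forall e', e' \in G -> {in e' &, injective typ}) ->
  (forall u, typ u = 0%N -> #|[set e' in G | u \in e']|%:R <= D) ->
  0 <= alpha <= 1 -> alpha ^+ 2 * D <= 1 ->
  e \in G -> v \in e -> typ v = 0%N -> depends_on e h ->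
  0 <= E (fun s => h s * (coef e s * middle e s)) ->
  2^-1 * sin alpha * E (fun s => h s * (coef e s * middle e s)) <=
  E (fun s => h s * sin (signal G v s)).
Proof.
move=> lin inj deg a01 aD eG ve tv dh hq0; case/andP: (a01) => a0 a1.
pose G' := G :\ e; pose q s := coef e s * middle e s.
have sG : G' \subset G by apply: subD1set.
have sig s : signal G v s = alpha * q s + signal G' v s.
  rewrite !signal_edges (bigD1 e) ?eG//= mulrDr; congr (_ + _ * _).
  by apply: eq_bigl => e1; rewrite !inE andbAC [_ && (e1 != e)]andbC.
have dq : depends_on e q.
  apply: depends_on_comp2.
    apply: depends_onS (@coef_dep e); apply/subsetP => a; by rewrite inE => /andP[].
  by move=> s t st; apply: eq_bigr => w /andP[we _]; rewrite st.
have ds : depends_on (~: e) (signal G' v).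
  apply: signal_dep => e' ; rewrite !inE => /andP[e'e e'G] ve'.
  apply/subsetP => a; rewrite !inE => /andP[ae' ta]; apply/negP => ae.
  have av : a != v by apply: contraTneq ta => ->; rewrite tv.
  by move/eqP: e'e; apply; apply: (linear_edge_eq lin e'G eG av).
have dis : [disjoint e & ~: e] by rewrite disjoints_subset setCK.
have -> : E (fun s => h s * sin (signal G v s)) =
    E (fun s => sin alpha * (h s * q s * cos (signal G' v s)) +
      h s * cos (alpha * q s) * sin (signal G' v s)).
  apply: eq_expect => s; rewrite sig sinD.
  (* Here [q s] is 0, 1 or -1, and the sine is odd. *)
  have -> : sin (alpha * q s) = sin alpha * q s.
    rewrite /q; case: (coef_cases e s) => ->; case: (middle_cases inj s eG) => ->;
      by rewrite ?(mul0r, mulr0, mul1r, mulN1r, mulrN1, mulr1, opprK, sin0, sinN, oppr0).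
  ring.
rewrite expectD expectZ.
rewrite (@expect_indep _ _ _ ord0 _ _ (fun s => h s * q s) (fun s => cos (signal G' v s)) dis);
  [|exact: depends_on_comp2|exact: depends_on_comp].
rewrite (@expect_indep _ _ _ ord0 _ _ (fun s => h s * cos (alpha * q s))
    (fun s => sin (signal G' v s)) dis); last 2 first.
- exact: (depends_on_comp2 (fun a b => a * cos (alpha * b)) dh dq).
- exact: depends_on_comp.
rewrite expect_sin_signal// mulr0 addr0.
have deg' u : typ u = 0%N -> #|[set e' in G' | u \in e']|%:R <= D.
  move=> /deg; apply: le_trans; rewrite ler_nat; apply: subset_leq_card.
  by apply/subsetP => e'; rewrite !inE => /andP[/andP[_ ->] ->].
have inj' e' : e' \in G' -> {in e' &, injective typ}.
  by move=> /(subsetP sG); apply: inj.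
have c := expect_cos_signal (linear_sub sG lin) inj' deg' a01 aD tv.
have s0 : 0 <= sin alpha by apply: le_trans (sin_ge_half a01); lra.
rewrite -mulrA mulrCA ler_wpM2l// mulrC ler_wpM2l//.
Qed.

End Signal.

(** * Gain of a good edge *)

Section Cuts.
Context {V : finType} {r : nat}.
Local Notation C := 'I_r.+2.
Implicit Types (e : {set V}) (s : {ffun V -> C}) (G : {set {set V}}).

Definition meets_all e s := [forall i : C, e :&: cut_part s i != set0].

Lemma meets_allP e s : reflect (forall i, exists2 x, x \in e & s x = i) (meets_all e s).
Proof.
apply: (iffP forallP) => H i.
  by have /set0Pn [x] := H i; rewrite !inE => /andP[xe /eqP si]; exists x.
by have [x xe si] := H i; apply/set0Pn; exists x; rewrite !inE xe si eqxx.
Qed.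

Lemma meets_all_dep e : depends_on e (meets_all e).
Proof.
by move=> s t st; apply/meets_allP/meets_allP => H i; have [x xe si] := H i;
  exists x; rewrite // -si st.
Qed.

Lemma cut_size_sum (R : numDomainType) (E : {set {set V}}) s :
  (cut_size E s)%:R = \sum_(e in E) (meets_all e s)%:R :> R.
Proof.
rewrite /cut_size -sum1_card natr_sum big_mkcond [RHS]big_mkcond /=.
by apply: eq_bigr => e _; rewrite !inE /meets_all; case: (e \in E) => //=; case: ifP.
Qed.

(* If the vertices of type at least 2 of an edge follow the first pattern, then the
   event that it is cut is uncorrelated with the product of the thetas of its other
   two vertices; with the second pattern the correlation is negative. *)
Definition pattern_neutral (n : nat) : C := if n == 2%N then ord0 else inord 1.
Definition pattern_sensitive (n : nat) : C := inord (minn n r.+1).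

Definition extend (i j : C) (h : nat -> C) (n : nat) : C :=
  if n is n'.+1 then if n' is 0 then j else h n else i.

Definition onto (k : nat) (h : nat -> C) := [forall c : C, [exists n : 'I_k, h n == c]].

Lemma ontoP k h : reflect (forall c, exists2 n, (n < k)%N & h n = c) (onto k h).
Proof.
apply: (iffP forallP) => H c.
  by have /existsP [n /eqP hn] := H c; exists n.
by have [n nk hn] := H c; apply/existsP; exists (Ordinal nk); rewrite /= hn.
Qed.

End Cuts.

Section Gain.
Context {R : realType} {V : finType} {r : nat}.
Local Notation C := 'I_r.+2.
Local Notation E := (@expect R V C).
Implicit Types (e : {set V}) (s : {ffun V -> C}) (G : {set {set V}}).
Variables (k : nat) (typ : V -> nat).
Hypothesis kr : (r.+2 <= k)%N.
Hypothesis k4 : (4 <= k)%N \/ (1 <= r)%N.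
Local Notation fn := (@pattern_neutral r).
Local Notation fs := (@pattern_sensitive r).

Let o1 : C := inord 1.

Lemma theta_ord (c : C) : theta c = (c == ord0)%:R - (c == o1)%:R :> R.
Proof. by rewrite /theta -!val_eqE /= inordK. Qed.

(** Mixed second difference of the event that an edge is cut, in the colours 0 and 1 of its vertices
    of types 0 and 1, the others following [h]. *)
Definition onto_defect (h : nat -> C) : R :=
  (onto k (extend ord0 ord0 h))%:R - (onto k (extend ord0 o1 h))%:R
  - (onto k (extend o1 ord0 h))%:R + (onto k (extend o1 o1 h))%:R.

(** With two colours and [k >= 4], types 2 and 3 already show both colours and the four terms are 1.
    With more colours, colour 2 is always missing and the four terms are 0. *)
Lemma onto_defect_neutral : onto_defect fn = 0.
Proof.
have [r0|r0] := posnP r.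
  have k4' : (4 <= k)%N by case: k4; rewrite ?r0.
  have H i j : onto k (extend i j fn) = true.
    apply/ontoP => c; have : (c < 2)%N by have := ltn_ord c; rewrite {2}r0.
    case: (posnP c) => [c0 _|c0 c2]; [exists 2%N|exists 3%N]; rewrite ?(ltnW k4')//.
      by apply: val_inj; rewrite /= c0.
    by apply: val_inj; rewrite /= inordK//; apply/eqP; rewrite eqn_leq c0 -ltnS c2.
  by rewrite /onto_defect !H; ring.
have H (i j : C) : (i <= 1)%N -> (j <= 1)%N -> onto k (extend i j fn) = false.
  move=> i1 j1; apply/ontoP => /(_ (inord 2)) [n _ /(congr1 val)].
  rewrite /= inordK; last by rewrite !ltnS.
  case: n => [|[|n]] /=; first by move=> h; rewrite h in i1.
    by move=> h; rewrite h in j1.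
  by rewrite /pattern_neutral; case: ifP => // _; rewrite inordK.
by rewrite /onto_defect !H ?inordK//; ring.
Qed.

(** The types from 2 on supply every colour from 2 on but never colour 0. So colours 0 and 1 on the
    first two types, in either order, complete the list, and colour 1 on both does not; the
    remaining term is at most 1. *)
Lemma onto_defect_sensitive : onto_defect fs <= -1.
Proof.
have k2 : (2 <= k)%N by apply: leq_trans kr.
have big (c : C) i j : (1 < c)%N -> exists2 n, (n < k)%N & extend i j fs n = c.
  move=> c1; exists c; first exact: leq_trans (ltn_ord c) kr.
  case: c c1 => [[|[|c]] cr] //= _; apply: val_inj; rewrite /= inordK.
    by apply/minn_idPl.
  by rewrite ltnS geq_minr.
have small (c : C) : (c <= 1)%N -> c = ord0 \/ c = o1.
  by case: c => [[|[|c]] cr] //= _; [left|right]; apply: val_inj; rewrite /= ?inordK.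
have S01 : onto k (extend ord0 o1 fs) = true.
  apply/ontoP => c; have [/small [->|->]|/big//] := leqP c 1.
    by exists 0%N; rewrite // (ltn_trans _ k2).
  by exists 1%N.
have S10 : onto k (extend o1 ord0 fs) = true.
  apply/ontoP => c; have [/small [->|->]|/big//] := leqP c 1.
    by exists 1%N.
  by exists 0%N; rewrite // (ltn_trans _ k2).
have S11 : onto k (extend o1 o1 fs) = false.
  apply/ontoP => /(_ ord0) [n _ /(congr1 val)] /=.
  case: n => [|[|n]] /=; rewrite inordK// ?ltnS ?geq_minr//.
  by move/eqP; rewrite -leqn0 geq_min.
rewrite /onto_defect S01 S10 S11; case: (onto _ _) => /=; lra.
Qed.

Lemma typ_onto e n :
  #|e| = k -> {in e &, injective typ} -> (forall x, x \in e -> (typ x < k)%N) ->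
  (n < k)%N -> exists2 x, x \in e & typ x = n.
Proof.
move=> ek inj tk nk; pose t x : 'I_k := insubd (Ordinal nk) (typ x).
have tE x : x \in e -> t x = typ x :> nat by move=> xe; rewrite val_insubd tk.
have tinj : {in e &, injective t}.
  by move=> x y xe ye /(congr1 val) /=; rewrite !tE//; apply: inj.
have : t @: e = [set: 'I_k].
  by apply/eqP; rewrite eqEcard subsetT cardsT card_ord card_in_imset// ek leqnn.
move=> /setP /(_ (Ordinal nk)); rewrite inE => /imsetP [x xe ex].
by exists x => //; rewrite -tE// -ex.
Qed.

Lemma expect_cylinder_meets e (h : nat -> C) :
  #|e| = k -> {in e &, injective typ} -> (forall x, x \in e -> (typ x < k)%N) ->
  E (fun s => (meets_all e s)%:R * \prod_(a in e) (s a == h (typ a))%:R) =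
  r.+2%:R^-1 ^+ k * (onto k h)%:R.
Proof.
move=> ek inj tk.
have sur n := typ_onto ek inj tk (n := n).
have -> : r.+2%:R^-1 ^+ k = E (fun s => \prod_(a in e) (s a == h (typ a))%:R).
  by rewrite (expect_cylinder ord0 e (fun a => h (typ a))) card_ord ek.
rewrite mulrC -expectZ; apply: eq_expect => s.
have [/forall_inP hs|] := boolP [forall a in e, s a == h (typ a)].
  congr (_%:R * _); congr nat_of_bool; apply/meets_allP/ontoP => H c; have [x xe <-] := H c.
    by exists (typ x); rewrite ?tk//; apply/esym/eqP/hs.
  by have [y ye <-] := sur x xe; exists y => //; apply/eqP/hs.
rewrite negb_forall_in => /existsP [a /andP[ae /negbTE sa]].
by rewrite (bigD1 a)//= sa !mul0r !mulr0.
Qed.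

(** The product of the two thetas is a signed sum over four colour choices, each of which, joined
    with a pattern, prescribes all of [e]. The mean is [r.+2%:R^-1 ^+ k] times the neutral defect
    minus the sensitive one. *)
Lemma gain_coef e v :
  #|e| = k -> {in e &, injective typ} -> (forall x, x \in e -> (typ x < k)%N) ->
  v \in e -> typ v = 0%N ->
  r.+2%:R^-1 ^+ k <=
  E (fun s => (meets_all e s)%:R * theta (s v) * (coef typ fn fs e s * middle typ e s)).
Proof.
move=> ek inj tk ve tv.
have k2 : (2 <= k)%N by apply: leq_trans kr.
have [w we tw] := typ_onto ek inj tk k2.
have wv : w != v by apply: contra_eq_neq tw => ->; rewrite tv.
have mid s : middle typ e s = theta (s w) :> R.
  rewrite /middle (big_pred1 w)// => x; apply/andP/eqP => [[xe /eqP tx]|->].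
    by apply: (inj _ _ xe we); rewrite tw.
  by rewrite tw.
have cyl i j (h : nat -> C) s :
    (s v == i)%:R * (s w == j)%:R * pattern typ h e s =
    \prod_(a in e) (s a == extend i j h (typ a))%:R :> R.
  rewrite (bigD1 v)//= (bigD1 w) /= ?we//= tv tw /= mulrA; congr (_ * _).
  rewrite /pattern; apply: eq_big => a; last first.
    rewrite inE => /andP[ae]; case: (typ a) => [|[|n]] //.
  rewrite inE -andbA; case ae : (a \in e) => //=.
  apply/idP/andP => [ta|[av aw]].
    by split; apply: contraTneq ta => ->; rewrite ?tv ?tw.
  case ta : (typ a) => [|[|n]] //.
    by case/eqP: av; apply: (inj _ _ ae ve); rewrite tv.
  by case/eqP: aw; apply: (inj _ _ ae we); rewrite tw.
have Eh (h : nat -> C) :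
    E (fun s => (meets_all e s)%:R * (theta (s v) * theta (s w) * pattern typ h e s)) =
    r.+2%:R^-1 ^+ k * onto_defect h.
  pose c i j s : R := (meets_all e s)%:R * \prod_(a in e) (s a == extend i j h (typ a))%:R.
  rewrite (@eq_expect _ _ _ _
    (fun s => c ord0 ord0 s - c ord0 o1 s - c o1 ord0 s + c o1 o1 s)); last first.
    by move=> s; rewrite /c -!cyl !theta_ord; ring.
  rewrite expectD !expectB /c !expect_cylinder_meets//.
  by rewrite /onto_defect; ring.
rewrite (@eq_expect _ _ _ _ (fun s =>
  (meets_all e s)%:R * (theta (s v) * theta (s w) * pattern typ fn e s) -
  (meets_all e s)%:R * (theta (s v) * theta (s w) * pattern typ fs e s))); last first.
  by move=> s; rewrite mid /coef; ring.
rewrite expectB !Eh onto_defect_neutral mulr0 sub0r -mulrN ler_peMr ?exprn_ge0 ?invr_ge0//.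
by have := onto_defect_sensitive; lra.
Qed.

End Gain.

(** * The biased colouring *)

Lemma prod1D_subset (R : comRingType) (I : finType) (U : {set I}) (x : I -> R) :
  \prod_(i in U) (1 + x i) = \sum_(T : {set I} | T \subset U) \prod_(i in T) x i.
Proof.
rewrite big_mkcond /=.
rewrite (eq_bigr (fun i => (if i \in U then x i else 0) + 1)) => [|i _]; last first.
  by case: ifP => _; rewrite addrC ?addr0.
rewrite bigA_distr [RHS]big_mkcond /=; apply: eq_bigr => T _.
rewrite -big_mkcond /=; case: ifP => [/subsetP TU|/negbT /subsetPn [i iT iU]].
  by apply: eq_bigr => i /TU ->.
by rewrite (bigD1 i)//= (negbTE iU) mul0r.
Qed.

Section Density.
Context {R : realType} {V : finType} {r : nat}.
Local Notation C := 'I_r.+2.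
Local Notation E := (@expect R V C).
Implicit Types (e T U : {set V}) (s : {ffun V -> C}) (G : {set {set V}}).
Variables (k : nat) (typ : V -> nat) (alpha p D : R) (H G : {set {set V}}) (U : {set V}).
Hypothesis kr : (r.+2 <= k)%N.
Hypothesis k4 : (4 <= k)%N \/ (1 <= r)%N.
Hypothesis Hk : uniform_hypergraph k H.
Hypothesis Hlin : linear_hypergraph H.
Hypothesis GH : G \subset H.
Hypothesis Ginj : forall e, e \in G -> {in e &, injective typ}.
Hypothesis typ_k : forall x, (typ x < k)%N.
Hypothesis typ_U : forall v, v \in U -> typ v = 0%N.
Hypothesis GU : forall e v, e \in G -> v \in e -> typ v = 0%N -> v \in U.
Hypothesis Hdeg : forall v, v \in U -> #|[set e in H | v \in e]|%:R <= D.
Hypothesis D0 : 0 <= D.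
Hypothesis alpha01 : 0 <= alpha <= 1.
Hypothesis alphaD : alpha ^+ 2 * D <= 1.
Hypothesis p01 : 0 <= p <= 1.

Let k0 : (0 < k)%N. Proof. exact: leq_trans kr. Qed.
Let Glin : linear_hypergraph G. Proof. exact: linear_sub GH Hlin. Qed.

Local Notation fn := (@pattern_neutral r).
Local Notation fs := (@pattern_sensitive r).
Local Notation sig := (signal typ fn fs alpha G).

Lemma good_degree v : typ v = 0%N -> #|[set e in G | v \in e]|%:R <= D.
Proof.
move=> tv; have [vU|vU] := boolP (v \in U).
  apply: le_trans (Hdeg vU); rewrite ler_nat; apply: subset_leq_card.
  by apply/subsetP => e; rewrite !inE => /andP[/(subsetP GH) -> ->].
rewrite (_ : [set _ in _ | _] = set0) ?cards0//.
apply/setP => e; rewrite !inE; apply/negP => /andP[eG ve].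
by have := GU eG ve tv; rewrite (negbTE vU).
Qed.

(** Density of the biased colouring relative to the uniform one. The bias acts on vertices of type
    0, while the signals see only positive types. *)
Definition density s : R := \prod_(v in U) (1 + p * (theta (s v) * sin (sig v s))).

Lemma density_ge0 s : 0 <= density s.
Proof.
case/andP: p01 => p0 p1; apply: prodr_ge0 => v _.
have : `|p * (theta (s v) * sin (sig v s))| <= 1.
  by rewrite normrM (ger0_norm p0) mulr_ile1// normrM mulr_ile1 ?theta_norm ?sin_max.
by rewrite ler_norml => /andP[h _]; rewrite -lerBlDl sub0r.
Qed.

Definition density_term T s : R := \prod_(v in T) (theta (s v) * sin (sig v s)).

Lemma expect_density_expand (F : {ffun V -> C} -> R) :
  E (fun s => F s * density s) =
  \sum_(T : {set V} | T \subset U) p ^+ #|T| * E (fun s => F s * density_term T s).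
Proof.
under [RHS]eq_bigr do rewrite -expectZ.
rewrite -expect_sum; apply: eq_expect => s.
rewrite /density prod1D_subset mulr_sumr; apply: eq_bigr => T _.
by rewrite big_split prodr_const mulrCA.
Qed.

Lemma signal_dep_type v : depends_on [set x | (0 < typ x)%N] (sig v).
Proof.
by apply: signal_dep => e _ _; apply/subsetP => x; rewrite !inE => /andP[].
Qed.

(** For [v] in [T] outside [e], the colour of [v] enters only through [theta (s v)], which has mean
    zero. *)
Lemma density_term_vanish e T (F : {ffun V -> C} -> R) :
  depends_on e F -> T \subset U -> ~~ (T \subset e) ->
  E (fun s => F s * density_term T s) = 0.
Proof.
move=> dF TU /subsetPn [v vT ve].
have tv := typ_U (subsetP TU _ vT).
rewrite (@eq_expect _ _ _ _ (fun s => theta (s v) *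
  (sin (sig v s) * F s * density_term (T :\ v) s))); last first.
  by move=> s; rewrite /density_term (big_setD1 v)//=; ring.
have dis : [disjoint [set v] & ~: [set v]] by rewrite disjoints_subset setCK.
have dsig u : depends_on (~: [set v]) (sig u).
  apply: depends_onS (@signal_dep_type u); apply/subsetP => x; rewrite !inE.
  by apply: contraTneq => ->; rewrite tv.
rewrite (@expect_indep _ _ _ ord0 _ _ (fun s => theta (s v)) _ dis).
- by rewrite expect_theta mul0r.
- by move=> s t st; rewrite st ?set11.
apply: depends_on_comp2; first apply: depends_on_comp2.
- exact: depends_on_comp.
- by apply: depends_onS dF; rewrite subsetC sub1set inE.
apply: depends_on_big => u; rewrite !inE => /andP[uv uT].
apply: depends_on_comp2; last exact: depends_on_comp.
by move=> s t st; rewrite st// !inE.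
Qed.

Lemma density_term0 s : density_term set0 s = 1.
Proof. by rewrite /density_term big_set0. Qed.

Lemma expect_density : E density = 1.
Proof.
rewrite (@eq_expect _ _ _ _ (fun s => 1 * density s)) => [|s]; last by rewrite mul1r.
rewrite expect_density_expand (bigD1 set0) ?sub0set//= cards0 expr0 mul1r.
rewrite big1 ?addr0 => [|T /andP[TU T0]].
  rewrite -[RHS](expect_cst ord0 (V := V) (C := C)).
  by apply: eq_expect => s; rewrite density_term0 mul1r.
by rewrite (@density_term_vanish set0) ?mulr0// subset0.
Qed.

Let cut e s : R := (meets_all e s)%:R.
Let cut_dep e : depends_on e (cut e).
Proof. exact: (depends_on_comp (fun b : bool => b%:R : R) (@meets_all_dep V r e)). Qed.

(** As [e] has a single vertex [v] of type 0, only the terms of the empty set and of [[set v]]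
    survive. *)
Lemma expect_density_good e : e \in G ->
  E (cut e) + p / 2 * sin alpha * r.+2%:R^-1 ^+ k <= E (fun s => cut e s * density s).
Proof.
move=> eG; case/andP: p01 => p0 p1; case/andP: (alpha01) => a0 a1.
have eH := subsetP GH _ eG.
have [v ve tv] := typ_onto (Hk eH) (Ginj eG) (fun x _ => typ_k x) k0.
have vU := GU eG ve tv.
have v0 : [set v] != set0 by apply/set0Pn; exists v; rewrite set11.
rewrite expect_density_expand (bigD1 set0) ?sub0set//=.
rewrite (bigD1 [set v]) ?sub1set ?vU//= big1 ?addr0; last first.
  move=> T /andP[/andP[TU T0] Tv]; rewrite (density_term_vanish (@cut_dep e))// ?mulr0//.
  apply: contra Tv => /subsetP Te; rewrite eqEsubset sub1set.
  have Tsub : T \subset [set v].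
    apply/subsetP => u uT; rewrite inE; apply/eqP; apply: (Ginj eG (Te _ uT) ve).
    by rewrite tv typ_U// (subsetP TU).
  case/set0Pn: T0 => u uT; rewrite Tsub /=.
  by have := subsetP Tsub _ uT; rewrite inE => /eqP <-.
rewrite cards0 cards1 expr0 mul1r expr1; apply: lerD.
  by rewrite le_eqVlt; apply/orP; left; apply/eqP/eq_expect => s;
    rewrite density_term0 mulr1.
rewrite -!mulrA ler_wpM2l//.
rewrite (@eq_expect _ _ _ _ (fun s => cut e s * theta (s v) * sin (sig v s))); last first.
  by move=> s; rewrite /density_term big_set1 mulrA.
have gain := gain_coef (R := R) kr k4 (Hk eH) (Ginj eG) (fun x _ => typ_k x) ve tv.
have N0 : 0 <= r.+2%:R^-1 ^+ k :> R by rewrite exprn_ge0// invr_ge0.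
apply: le_trans (expect_mul_sin_signal Glin Ginj good_degree alpha01 alphaD eG ve tv _ _).
- rewrite mulrA ler_wpM2l//; first by have := sin_ge_half alpha01; lra.
- apply: depends_on_comp2; first exact: cut_dep.
  by move=> s t st; rewrite st.
- exact: le_trans gain.
Qed.

(** Only subsets [T] of [e] contribute. Singletons give 0, since the sine of a signal has mean zero;
    larger sets carry at least [p ^+ 2] and a product of sines of order [alpha]. *)
Lemma expect_density_bad e : e \in H -> e \notin G ->
  E (cut e) - 2 ^+ k * (p ^+ 2 * (2 * k%:R ^+ 4 * alpha)) <=
  E (fun s => cut e s * density s).
Proof.
move=> eH eG; case/andP: p01 => p0 p1; case/andP: (alpha01) => a0 a1.
set d := p ^+ 2 * _.
have d0 : 0 <= d by rewrite !mulr_ge0// exprn_ge0.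
rewrite expect_density_expand (bigD1 set0) ?sub0set//= cards0 expr0 mul1r.
apply: lerD.
  by rewrite le_eqVlt; apply/orP; left; apply/eqP/eq_expect => s;
    rewrite density_term0 mulr1.
rewrite (bigID (fun T : {set V} => T \subset e)) /= [X in _ + X]big1 ?addr0; last first.
  move=> T /andP[/andP[TU _] Te].
  by rewrite (density_term_vanish (@cut_dep e))// mulr0.
rewrite lerNl -sumrN.
apply: (@le_trans _ _ (\sum_(T in powerset e) d)); last first.
  by rewrite sumr_const card_powerset Hk// -[leLHS]mulr_natl natrX.
rewrite [leRHS](bigID (fun T : {set V} => (T \subset U) && (T != set0))) /=.
rewrite -[leLHS]addr0 lerD//; last exact: sumr_ge0.
rewrite [leRHS](eq_bigl (fun T : {set V} => (T \subset U) && (T != set0) && (T \subset e)));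
  last by move=> T; rewrite powersetE andbC.
apply: ler_sum => T /andP[/andP[TU T0] Te].
have T_typ v : v \in T -> typ v = 0%N by move=> vT; rewrite typ_U// (subsetP TU).
rewrite (@eq_expect _ _ _ _ (fun s => (cut e s * \prod_(v in T) theta (s v)) *
    \prod_(v in T) sin (sig v s))); last first.
  by move=> s; rewrite /density_term big_split mulrA.
(* As [e] is not in [G], an edge of [G] through a vertex of [T] meets [e] only there; the signals of
   [T] thus ignore the colours on [e] and the mean factors. *)
have dis : [disjoint e & ~: e] by rewrite disjoints_subset setCK.
rewrite (expect_indep ord0 dis); last 2 first.
- apply: depends_on_comp2; first exact: cut_dep.
  apply: depends_on_big => v vT s t st; rewrite st//; exact: (subsetP Te).
- apply: depends_on_big => v vT; apply: depends_on_comp.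
  apply: signal_dep => e' e'G ve'; apply/subsetP => x; rewrite !inE => /andP[xe' tx].
  apply: contra eG => xe.
  have xv : x != v by apply: contraTneq tx => ->; rewrite T_typ.
  by rewrite (linear_edge_eq Hlin eH (subsetP GH _ e'G) xv xe (subsetP Te _ vT) xe' ve').
have Tk : (#|T| <= k)%N by rewrite -(Hk eH) subset_leq_card.
have c1 : `|E (fun s => cut e s * \prod_(v in T) theta (s v))| <= 1.
  apply: le_trans (ler_norm_expect _) _.
  rewrite -[leRHS](expect_cst ord0 (V := V) (C := C)); apply: ler_expect => s.
  rewrite normrM mulr_ile1//; first by rewrite /cut; case: (meets_all e s); rewrite ?normr1 ?normr0.
  rewrite normr_prod; apply: prodr_ile1 => v vT; rewrite normr_ge0; exact: theta_norm.
have [T1|T2] := leqP #|T| 1.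
  have /cards1P [v Tv] : #|T| == 1%N by rewrite eqn_leq T1 card_gt0.
  rewrite [X in _ * (_ * X)](_ : _ = 0) ?mulr0 ?oppr0//.
  rewrite Tv; under eq_expect do rewrite big_set1.
  by apply: expect_sin_signal; apply: T_typ; rewrite Tv set11.
have pT : p ^+ #|T| <= p ^+ 2 by rewrite ler_wiXn2l.
apply: le_trans (ler_norm _) _; rewrite normrN normrM.
rewrite ger0_norm ?exprn_ge0// ler_pM ?exprn_ge0 ?mulr_ge0//.
rewrite normrM; apply: le_trans (ler_piMl _ c1) _ => //.
exact: (expect_prod_sin _ _ Glin (fun e' e'G => eq_leq (Hk (subsetP GH _ e'G))) Ginj
  good_degree alpha01 alphaD).
Qed.

Lemma exists_cut_good :
  exists s : {ffun V -> C},
    \sum_(e in H) E (cut e) + #|G|%:R * (p / 2 * sin alpha * r.+2%:R^-1 ^+ k)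
    - #|H|%:R * (2 ^+ k * (p ^+ 2 * (2 * k%:R ^+ 4 * alpha))) <= (cut_size H s)%:R.
Proof.
case/andP: p01 => p0 p1; case/andP: (alpha01) => a0 a1.
apply: (expect_exists_ge density_ge0 expect_density).
rewrite (@eq_expect _ _ _ _ (fun s => \sum_(e in H) cut e s * density s)); last first.
  by move=> s; rewrite cut_size_sum mulr_suml.
rewrite expect_sum; set a := p / 2 * _ * _; set b := 2 ^+ k * _.
have b0 : 0 <= b by rewrite !mulr_ge0// exprn_ge0.
have -> : #|G|%:R * a = \sum_(e in H) (e \in G)%:R * a.
  rewrite -mulr_suml; congr (_ * _); rewrite -natr_sum -sum1_card; congr _%:R.
  rewrite big_mkcond [RHS]big_mkcond; apply: eq_bigr => e _.
  by have := subsetP GH e; case: (e \in G); case: (e \in H) => // /(_ erefl).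
have -> : #|H|%:R * b = \sum_(e in H) b by rewrite sumr_const -[RHS]mulr_natl.
rewrite -big_split -sumrB /=; apply: ler_sum => e eH.
case eG : (e \in G); rewrite ?mul1r ?mul0r ?addr0.
  by apply: le_trans (expect_density_good eG); rewrite gerBl.
by apply: expect_density_bad => //; rewrite eG.
Qed.

End Density.

(** * Random cuts and Stirling numbers *)

Section Stirling.
Variables (k n : nat).
Local Notation C := 'I_n.+1.

Definition label (P : {set {set 'I_k}}) (p : {perm C}) : {ffun 'I_k -> C} :=
  [ffun x => p (inord (index (pblock P x) (enum P)))].

Section Label.
Variables (P : {set {set 'I_k}}) (p : {perm C}).
Hypothesis partP : finset.partition P [set: 'I_k].
Hypothesis cardP : #|P| = n.+1.

Lemma pblock_in x : pblock P x \in P.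
Proof. by rewrite pblock_mem// (cover_partition partP) inE. Qed.

Lemma label_eq x y : (label P p x == label P p y) = (pblock P x == pblock P y).
Proof.
rewrite !ffunE (inj_eq perm_inj) -val_eqE /= !inordK; last 2 first.
- by rewrite -cardP cardE index_mem mem_enum pblock_in.
- by rewrite -cardP cardE index_mem mem_enum pblock_in.
by rewrite (inj_in_eq (@index_inj _ set0 (enum P)))// ?mem_enum ?pblock_in.
Qed.

Lemma label_fiber x : [set y | label P p y == label P p x] = pblock P x.
Proof.
have trivP : trivIset P by case/and3P: partP.
have covx : x \in cover P by rewrite (cover_partition partP) inE.
apply/setP => y; rewrite inE label_eq eq_sym.
by rewrite eq_pblock.
Qed.

Lemma label_onto c : exists x, forall q, label P q x = q c.
Proof.
have cs : (c < size (enum P))%N by rewrite -cardE cardP.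
have BP : nth set0 (enum P) c \in P by rewrite -mem_enum mem_nth.
have [trivP n0] : trivIset P /\ set0 \notin P by case/and3P: partP.
have /set0Pn [x xB] : nth set0 (enum P) c != set0 by apply: contraNneq n0 => <-.
exists x => q; rewrite ffunE (def_pblock trivP BP xB) index_uniq ?enum_uniq//.
by congr (q _); apply: val_inj; rewrite /= inordK.
Qed.

Lemma label_blocks : P = [set [set y | label P p y == label P p x] | x in 'I_k].
Proof.
apply/setP => B; apply/idP/imsetP => [BP|[x _ ->]]; last by rewrite label_fiber pblock_in.
have [trivP n0] : trivIset P /\ set0 \notin P by case/and3P: partP.
have /set0Pn [x xB] : B != set0 by apply: contraNneq n0 => <-.
by exists x; rewrite // label_fiber (def_pblock trivP BP xB).
Qed.

End Label.

(** A labelling determines its pair: the fibres are the blocks of the partition, and the values on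
    them give the permutation. This direction suffices because the surplus subtracts the Stirling
    term. *)
Lemma stirling2_le_surj :
  (stirling2 k n.+1 * n.+1`! <=
   #|[set h : {ffun 'I_k -> C} | [forall c, [exists x, h x == c]]]|)%N.
Proof.
rewrite /stirling2; set S := [set P | _]; rewrite -card_Sn -cardsT -cardsX.
pose F (z : {set {set 'I_k}} * {perm C}) := label z.1 z.2.
have SP P : P \in S -> finset.partition P [set: 'I_k] /\ #|P| = n.+1.
  by rewrite inE => /andP[? /eqP].
rewrite -(card_in_imset (f := F)); last first.
  move=> [P p] [Q q]; rewrite !in_setX => /andP[/SP [pP cP] _] /andP[/SP [pQ cQ] _].
  rewrite /F /= => eF.
  have ePQ : P = Q by rewrite (label_blocks p pP cP) (label_blocks q pQ cQ) eF.
  congr (_, _) => //; apply/permP => c.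
  have [x lx] := label_onto pP cP c.
  by rewrite -!lx eF ePQ.
apply: subset_leq_card; apply/subsetP => h /imsetP [[P p]].
rewrite in_setX => /andP[/SP [pP cP] _] ->; rewrite inE; apply/forallP => c.
have [x px] := label_onto pP cP ((p^-1)%g c).
by apply/existsP; exists x; rewrite /F /= px permKV.
Qed.

End Stirling.

Lemma expect_meets_all_ge (R : realType) (V : finType) (r k : nat) (e : {set V}) :
  (r.+2 <= k)%N -> #|e| = k ->
  (stirling2 k r.+2 * r.+2`!)%:R / r.+2%:R ^+ k <=
  expect (fun s : {ffun V -> 'I_r.+2} => (meets_all e s)%:R) :> R.
Proof.
move=> kr ek; have k0 : (0 < k)%N by apply: leq_trans kr.
have [v0 v0e] : exists v, v \in e by apply/card_gt0P; rewrite ek.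
(* The position in [enum e] serves as a type, so that [expect_cylinder_meets] applies. *)
pose tau x := index x (enum e).
have tau_k x : x \in e -> (tau x < k)%N by move=> xe; rewrite -ek cardE index_mem mem_enum.
have tau_inj : {in e &, injective tau}.
  by move=> x y xe ye; apply: (index_inj v0); rewrite mem_enum.
pose h (f : {ffun 'I_k -> 'I_r.+2}) n := f (insubd (Ordinal k0) n).
pose cyl f (s : {ffun V -> 'I_r.+2}) : R := \prod_(a in e) (s a == h f (tau a))%:R.
apply: (@le_trans _ _ (expect (fun s => \sum_f (meets_all e s)%:R * cyl f s))); last first.
  apply: ler_expect => s; rewrite -mulr_sumr ler_piMr//.
  pose f0 := [ffun n : 'I_k => s (nth v0 (enum e) n)].
  rewrite (bigD1 f0)//= big1 ?addr0 => [|f ff0].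
    by apply: prodr_ile1 => a _; rewrite ler0n lern1 leq_b1.
  have /existsP [n fn] : [exists n, f n != f0 n].
    rewrite -negb_forall; apply: contra ff0 => /forallP ff0.
    by apply/eqP/ffunP => n; apply/eqP.
  have ne : (n < size (enum e))%N by rewrite -cardE ek.
  have ae : nth v0 (enum e) n \in e by rewrite -mem_enum mem_nth.
  rewrite /cyl (bigD1 (nth v0 (enum e) n))//= /tau index_uniq ?enum_uniq//.
  rewrite /h valKd (_ : _ == _ = false) ?mul0r//.
  by apply: contraNF fn => /eqP <-; rewrite ffunE.
rewrite expect_sum.
under eq_bigr => f _ do rewrite (expect_cylinder_meets (h f) ek tau_inj tau_k).
rewrite -mulr_sumr mulrC exprVn ler_wpM2l ?invr_ge0 ?exprn_ge0// -natr_sum ler_nat.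
apply: leq_trans (stirling2_le_surj _ _) _; rewrite -sum1_card big_mkcond /=.
apply: leq_sum => f _; rewrite inE; case: ifP => // fo; rewrite lt0b.
apply/forallP => c; have /existsP [n /eqP fn] := forallP fo c.
by apply/existsP; exists n; rewrite /h valKd fn.
Qed.

(** * Types and degrees *)

Section Types.
Context {V : finType} {k : nat}.
Implicit Types (t : {ffun V -> 'I_k.+1}) (H : {set {set V}}) (L : {set V}).

Definition transversals H L t := [set e in H |
  [forall x in e, forall y in e, (t x == t y) ==> (x == y)] &&
  [forall v in e, (t v == ord0) ==> (v \in L)]].

(** First moment: an edge with a vertex [v] in [L] is good under one prescribed injective assignment
    of types. The transposition [tperm (i v) ord0] arranges that [v] gets type 0. *)
Lemma exists_transversals (R : realFieldType) H L : uniform_hypergraph k.+1 H ->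
  exists t, k.+1%:R^-1 ^+ k.+1 * #|[set e in H | e :&: L != set0]|%:R
    <= #|transversals H L t|%:R :> R.
Proof.
move=> Hk; apply: (@expect_exists_ge _ _ _ (fun=> 1)) => //.
  exact: (expect_cst ord0).
rewrite (@eq_expect _ _ _ _ (fun t => \sum_(e in H) (e \in transversals H L t)%:R)); last first.
  move=> t; rewrite mulr1 -sum1_card natr_sum big_mkcond [RHS]big_mkcond /=.
  by apply: eq_bigr => e _; rewrite inE; case: (e \in H) => //=; case: ifP.
rewrite expect_sum mulrC mulr_natl -sumr_const /=.
rewrite big_mkcond [leRHS]big_mkcond /=; apply: ler_sum => e _.
rewrite inE; case: ifP => [/andP[eH eL]|_]; last first.
  by case: ifP => // _; apply: expect_ge0.
rewrite eH; have /set0Pn [v] := eL; rewrite inE => /andP[ve vL].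
pose i x : 'I_k.+1 := inord (index x (enum e)).
have iE x : x \in e -> i x = index x (enum e) :> nat.
  by move=> xe; rewrite inordK// -(Hk _ eH) cardE index_mem mem_enum.
pose f x := tperm (i v) ord0 (i x).
have f_inj : {in e &, injective f}.
  move=> x y xe ye /perm_inj /(congr1 val) /=; rewrite !iE//.
  by apply: (index_inj v); rewrite mem_enum.
rewrite -{2}(Hk _ eH) -[X in X%:R^-1](card_ord k.+1) -(expect_cylinder ord0 e f).
apply: ler_expect => t.
have [/forall_inP tf|] := boolP [forall a in e, t a == f a]; last first.
  by rewrite negb_forall_in => /existsP [a /andP[ae /negbTE ta]]; rewrite (bigD1 a)//= ta mul0r.
rewrite big1 => [|a ae]; last by rewrite tf.
suff -> : e \in transversals H L t by [].
rewrite inE eH /=; apply/andP; split; apply/forall_inP => x xe.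
  apply/forall_inP => y ye; apply/implyP; rewrite (eqP (tf x xe)) (eqP (tf y ye)).
  by move=> /eqP/f_inj ->.
apply/implyP; rewrite (eqP (tf x xe)) -[X in _ == X](tpermL (i v) ord0) => /eqP /f_inj.
by move=> ->.
Qed.

End Types.

(* Pairs of high-degree vertices are few, and an edge without low-degree vertices
   contains such a pair that lies in no other edge. *)
Lemma low_degree_edges (R : realFieldType) (V : finType) (k : nat) (H : {set {set V}}) (D : R) :
  (2 <= k)%N -> uniform_hypergraph k H -> linear_hypergraph H -> 0 < D ->
  2 * (k%:R * #|H|%:R) ^+ 2 <= #|H|%:R * D ^+ 2 ->
  #|H|%:R / 2 <=
  #|[set e in H | e :&: [set v | #|[set f in H | v \in f]|%:R <= D] != set0]|%:R :> R.
Proof.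
move=> k2 Hk Hlin D0 hD; set L := [set v : V | #|[set f in H | v \in f]|%:R <= D].
pose A := [set e in H | e :&: L != set0]; rewrite -/A.
pose B := [set e in H | e :&: L == set0].
have cAB : #|H|%:R = #|A|%:R + #|B|%:R :> R.
  rewrite -natrD -(cardsID A H); congr (_ + _)%:R.
    by apply: eq_card => e; rewrite !inE; case: (e \in H).
  by apply: eq_card => e; rewrite !inE; case: (e \in H); rewrite ?andbF//= negbK andbT.
suff : #|B|%:R <= #|H|%:R / 2 :> R by rewrite cAB; lra.
(* Double counting: the degrees sum to [k] times the number of edges, and those outside [L] exceed
   [D]. *)
have hL : #|~: L|%:R * D <= k%:R * #|H|%:R.
  apply: (@le_trans _ _ (\sum_(v in ~: L) #|[set f in H | v \in f]|%:R)).
    rewrite mulr_natl -sumr_const; apply: ler_sum => v; rewrite !inE -ltNge.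
    exact: ltW.
  apply: (@le_trans _ _ (\sum_v \sum_(f in H) (v \in f)%:R)).
    rewrite [leLHS]big_mkcond; apply: ler_sum => v _; case: ifP => _; last exact: sumr_ge0.
    rewrite -sum1_card natr_sum big_mkcond [leRHS]big_mkcond /=.
    by apply: ler_sum => f _; rewrite inE; case: (f \in H) => //=; case: ifP.
  rewrite exchange_big /= mulr_natr -sumr_const; apply: ler_sum => f fH.
  rewrite -(Hk _ fH) -sum1_card natr_sum [leRHS]big_mkcond /=.
  by apply: ler_sum => v _; case: ifP.
have B2 : #|B|%:R <= #|~: L|%:R ^+ 2 :> R.
  pose I (u v : V) (e : {set V}) : R := [&& u != v, u \in e & v \in e]%:R.
  apply: (@le_trans _ _ (\sum_(u in ~: L) \sum_(v in ~: L) \sum_(e in B) I u v e)).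
    under eq_bigr do rewrite exchange_big; rewrite exchange_big /=.
    rewrite -sum1_card natr_sum; apply: ler_sum => e; rewrite inE => /andP[eH /eqP eL].
    have eL' x : x \in e -> x \in ~: L.
      by move=> xe; have := in_set0 x; rewrite -eL !inE xe /= => ->.
    have /card_gt1P [u [v [ue ve uv]]] : (1 < #|e|)%N by rewrite (Hk _ eH).
    rewrite (bigD1 u) ?eL'//= (bigD1 v) ?eL'//= {1}/I uv ue ve /= -addrA lerDl.
    by rewrite addr_ge0// ?sumr_ge0// => *; rewrite ?sumr_ge0.
  apply: (@le_trans _ _ (\sum_(u in ~: L) \sum_(v in ~: L) 1)); last first.
    by rewrite !sumr_const -[leLHS]mulr_natl expr2.
  apply: ler_sum => u _; apply: ler_sum => v _; rewrite /I.
  rewrite (eq_bigr (fun e : {set V} => if [&& u != v, u \in e & v \in e] then 1 else 0)) => [|e _];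
    last by case: ifP.
  rewrite -big_mkcondr /=; apply: le_trans (ler_norm _) _; apply: norm_sum_unique => //.
    move=> e1 e2 /andP[e1B /and3P[uv u1 v1]] /andP[e2B /and3P[_ u2 v2]].
    move: e1B e2B; rewrite !inE => /andP[e1H _] /andP[e2H _].
    exact: (linear_edge_eq Hlin e1H e2H uv).
  by move=> *; rewrite normr1.
have : #|B|%:R * D ^+ 2 <= (k%:R * #|H|%:R) ^+ 2.
  apply: le_trans (ler_wpM2r (sqr_ge0 D) B2) _; rewrite -exprMn.
  by rewrite ler_sqr ?nnegrE ?mulr_ge0// ltW.
have D2 : 0 < D ^+ 2 by rewrite exprn_gt0.
move=> h; rewrite -(ler_pM2r D2); lra.
Qed.

(** * Choice of the parameters and the exponent 3/4 *)

Lemma mul_powR_quarter (R : realType) (m : R) : 0 < m ->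
  m `^ (3 / 4) * Num.sqrt (Num.sqrt m) = m.
Proof.
move=> m0; have mn := lt0r_neq0 m0.
rewrite -[Num.sqrt m]powR12_sqrt ?ltW// -powR12_sqrt ?powR_ge0// -powRrM -powRD.
  by rewrite (_ : _ + _ = 1) ?powRr1 ?ltW//; field.
by rewrite (negbTE mn) implybT.
Qed.

Section Surplus.
Context {R : realType} {V : finType} {r k : nat}.
Variable E : {set {set V}}.
Hypothesis kr : (r.+2 <= k.+1)%N.
Hypothesis k4 : (4 <= k.+1)%N \/ (1 <= r)%N.
Hypothesis Ek : uniform_hypergraph k.+1 E.
Hypothesis Elin : linear_hypergraph E.
Local Notation kR := (k.+1%:R : R).
Local Notation m := (#|E|%:R : R).

(** With [alpha] the inverse square root of [D] and [q] equal to [kR^-1 ^+ k.+1], at least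
    [q * (m / 2)] edges are good and each gains at least [p / 2 * (alpha / 2) * q]. The subtracted
    term is the loss, charged to all edges. *)
Lemma exists_surplus (D p : R) : 2 * (kR * m) ^+ 2 <= m * D ^+ 2 -> 1 <= D -> 0 <= p <= 1 ->
  exists f : r_cut V r.+2,
    m / Num.sqrt D * (p * (kR^-1 ^+ k.+1) ^+ 2 / 8 - p ^+ 2 * (2 ^+ k.+2 * kR ^+ 4))
    <= surplus R k.+1 E f.
Proof.
move=> hD D1 p01; case/andP: (p01) => p0 p1.
have D0 : 0 < D by lra.
pose L := [set v : V | #|[set e in E | v \in e]|%:R <= D].
have [t ht] := exists_transversals R L Ek.
pose G := transversals E L t; pose typ v := val (t v).
pose U := [set v in L | t v == ord0].
pose alpha := (Num.sqrt D)^-1.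
have sD : 1 <= Num.sqrt D by rewrite -sqrtr1 ler_wsqrtr.
have a01 : 0 <= alpha <= 1 by rewrite invr_ge0 sqrtr_ge0 invf_le1// (lt_le_trans ltr01).
have aD : alpha ^+ 2 * D <= 1.
  rewrite exprVn sqr_sqrtr; last exact: ltW.
  by rewrite mulVf ?lexx// gt_eqF.
have GE : G \subset E by apply/subsetP => e; rewrite inE => /andP[].
have Ginj e : e \in G -> {in e &, injective typ}.
  rewrite inE => /andP[_ /andP[/forall_inP inj _]] x y xe ye /val_inj txy.
  by apply/eqP; apply: (implyP (forall_inP (inj x xe) y ye)); rewrite txy.
have GU e v : e \in G -> v \in e -> typ v = 0%N -> v \in U.
  rewrite inE => /andP[_ /andP[_ /forall_inP low]] ve tv.
  have t0 : t v == ord0 by apply/eqP/val_inj.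
  by rewrite inE t0 andbT; apply: (implyP (low v ve)).
have typU v : v \in U -> typ v = 0%N by rewrite inE => /andP[_ /eqP tv]; rewrite /typ tv.
have Udeg v : v \in U -> #|[set e in E | v \in e]|%:R <= D by rewrite !inE => /andP[].
have [s hs] := exists_cut_good kr k4 Ek Elin GE Ginj (fun x => ltn_ord (t x))
  typU GU Udeg (ltW D0) a01 aD p01.
exists s; rewrite /surplus.
have k2 : (2 <= k.+1)%N by apply: leq_trans kr.
have low := low_degree_edges k2 Ek Elin D0 hD.
have base : (stirling2 k.+1 r.+2 * (r.+2)`!)%:R / r.+2%:R ^+ k.+1 * m <=
    \sum_(e in E) expect (fun s : {ffun V -> 'I_r.+2} => (meets_all e s)%:R) :> R.
  rewrite mulr_natr -sumr_const; apply: ler_sum => e eE.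
  exact: expect_meets_all_ge (Ek eE).
set q := kR^-1 ^+ k.+1 in ht *.
have q0 : 0 <= q by rewrite exprn_ge0 ?invr_ge0.
have qr : q <= r.+2%:R^-1 ^+ k.+1.
  by rewrite ler_pXn2r ?nnegrE ?invr_ge0// lef_pV2 ?posrE// ler_nat.
have gG : q * (m / 2) <= #|G|%:R by apply: le_trans ht; rewrite ler_wpM2l.
have sa := sin_ge_half a01; case/andP: (a01) => a0 a1.
have gain : q * (m / 2) * (p / 2 * (alpha / 2) * q) <=
    #|G|%:R * (p / 2 * sin alpha * r.+2%:R^-1 ^+ k.+1).
  have pa : p / 2 * (alpha / 2) <= p / 2 * sin alpha by rewrite ler_wpM2l ?divr_ge0.
  have pa0 : 0 <= p / 2 * (alpha / 2) by rewrite mulr_ge0 ?divr_ge0.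
  have qm0 : 0 <= q * (m / 2) by rewrite mulr_ge0 ?divr_ge0.
  exact: (ler_pM qm0 (mulr_ge0 pa0 q0) gG (ler_pM pa0 q0 pa qr)).
apply: (@le_trans _ _ (q * (m / 2) * (p / 2 * (alpha / 2) * q) -
   m * (2 ^+ k.+1 * (p ^+ 2 * (2 * kR ^+ 4 * alpha))))); last by lra.
by rewrite le_eqVlt; apply/orP; left; apply/eqP; rewrite -/alpha [2 ^+ k.+2]exprS; field.
Qed.

End Surplus.

Theorem theorem1p5 (R : realType) (k : nat) :
  exists2 c : R, 0 < c &
    forall r : nat, (2 <= r <= k)%N -> (4 <= k)%N \/ (3 <= r)%N ->
    forall (V : finType) (E : {set {set V}}),
      uniform_hypergraph k E -> linear_hypergraph E ->
      exists f : r_cut V r, c * (#|E|%:R `^ (3 / 4)) <= surplus R k E f.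
Proof.
case: k => [|k]; first by exists 1 => // -[|[|r]].
set x : R := k.+1%:R.
have x1 : 1 <= x by rewrite ler1n.
pose a := (x^-1 ^+ k.+1) ^+ 2; pose b := 2 ^+ k.+2 * x ^+ 4.
have x0 : 0 < x by lra.
have a0 : 0 < a by rewrite !exprn_gt0 ?invr_gt0.
have a1 : a <= 1 by rewrite !exprn_ile1 ?exprn_ge0 ?invr_ge0 ?invf_le1// ltW.
have b1 : 1 <= b by rewrite mulr_ege1 ?exprn_ege1// ler1n.
have b0 : 0 < b by lra.
(* This makes the loss [p ^+ 2 * b] half of the gain [p * a / 8]. *)
pose p := a / (16 * b).
have p0 : 0 < p by rewrite divr_gt0// mulr_gt0.
have p1 : p <= 1.
  have b16 : 0 < 16 * b by rewrite pmulr_rgt0.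
  by rewrite ler_pdivrMr//; move: (a) (b) a1 b1 => u v u1 v1; lra.
have s0 : 0 < Num.sqrt (2 * x) by rewrite sqrtr_gt0 mulr_gt0.
exists (p * a / 16 / Num.sqrt (2 * x)); first by rewrite !divr_gt0// mulr_gt0.
move=> [|[|r]] // kr k4 V E Ek Elin.
have [E0|E0] := posnP #|E|.
  (* Without edges both sides are 0, the exponent 3/4 being nonzero. *)
  exists [ffun=> ord0]; rewrite /surplus E0 powR0 ?mulr0 ?subr0//.
  by rewrite mulf_eq0 invr_eq0 negb_or !pnatr_eq0.
have m1 : 1 <= #|E|%:R :> R by rewrite ler1n.
set m : R := #|E|%:R in m1 *.
have m0 : 0 < m by lra.
have sm : 1 <= Num.sqrt m by rewrite -sqrtr1 ler_wsqrtr.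
(* The order [Num.sqrt m] makes [m / Num.sqrt D] of order [m] to the power 3/4; the factor [2 * x]
   makes [D] large enough for [low_degree_edges]. *)
pose D := 2 * x * Num.sqrt m.
have D1 : 1 <= D by rewrite mulr_ege1//; lra.
have hD : 2 * (x * m) ^+ 2 <= m * D ^+ 2.
  have -> : D ^+ 2 = (2 * x) ^+ 2 * m by rewrite /D exprMn [Num.sqrt m ^+ 2]sqr_sqrtr// ltW.
  have -> : m * ((2 * x) ^+ 2 * m) = 4 * (x * m) ^+ 2 by ring.
  by rewrite ler_wpM2r ?sqr_ge0// ler_nat.
have k4' : (4 <= k.+1)%N \/ (1 <= r)%N by [].
have p01 : 0 <= p <= 1 by rewrite ltW.
have [f hf] := exists_surplus kr k4' Ek Elin hD D1 p01.
exists f; apply: le_trans hf; rewrite -/x -/m -/a -/b.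
rewrite le_eqVlt; apply/orP; left; apply/eqP.
have e : p * a / 8 - p ^+ 2 * b = p * a / 16 by rewrite /p; field; rewrite gt_eqF.
have sD : Num.sqrt D = Num.sqrt (2 * x) * Num.sqrt (Num.sqrt m).
  by rewrite /D sqrtrM// mulr_ge0// ltW.
rewrite e sD.
rewrite -[X in _ = X / _ * _](mul_powR_quarter m0).
have sm0 : 0 < Num.sqrt (Num.sqrt m) by rewrite !sqrtr_gt0.
by field; rewrite !gt_eqF.
Qed.
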